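(* Let $R$ be a commutative Noetherian ring with unity, $\lambda$ a length function on $R$-modules, $k\in\mathbb{N}$ and $S=R[x_1,\dots,x_k]$. Let $0\to A\xrightarrow{\iota} B\xrightarrow{\pi} C\to 0$ be an exact sequence of $S$-modules and assume that $B$ is locally $\lambda_R$-finite. Then $\mu(B)=\mu(A)\oplus\mu(C)$.
   Context: A length function on $R$-modules is a function $\lambda$ from $R$-modules to $\mathbb{R}_{\ge0}\cup\{\infty\}$ with $\lambda(0)=0$, invariant under isomorphism, additive on short exact sequences ($\lambda(B)=\lambda(A)+\lambda(C)$), and with $\lambda(M)=\sup\{\lambda(M'):M'\le M$ finitely generated $R$-submodule$\}$. An $R$-module (or $S$-module) $N$ is locally $\lambda_R$-finite if $\lambda(Rv)<\infty$ for every $v\in N$. An $S$-module $M$ is $\lambda_S$-small if it is finitely generated as an $S$-module and locally $\lambda_R$-finite. $S_n$ denotes the polynomials in $S$ of total degree $\le n$. If $M$ is $\lambda_S$-small (and $R$ Noetherian), choose a finitely generated $R$-submodule $V_0\le M$ with $\lambda(V_0)<\infty$ and $SV_0=M$; then $\lambda(S_nV_0)$ equals a polynomial $q(n)\in\mathbb{R}[n]$ of degree $\le k$ for all large $n$, and $\mu(M)$ is defined as the leading monomial $r t^d$ of $q$ (and $\mu(M)=0$ if $q=0$); it does not depend on $V_0$. Monomials $rt^d$ ($r\in\mathbb{R}_{\ge0}\cup\{\infty\}$, $d\in\{0,\dots,k\}$) are compared by: $rt^n\le st^m$ iff $n<m$, or $n=m$ and $r\le s$, with $0$ the minimum. For a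 family $I=\{r_it^{d_i}\}$, $\sup(I)=rt^d$ where $d=\max d_i$ and $r=\sup\{r_i: d_i=d\}$, and $\sup(\emptyset)=0$. For an arbitrary $S$-module $M$, $\mu(M)$ is the supremum of $\mu(M')$ over all $\lambda_S$-small $S$-submodules $M'\le M$. The operation $\oplus$ is: $rt^n\oplus st^m=rt^n$ if $n>m$, $=st^m$ if $n<m$, $=(r+s)t^n$ if $n=m$ (with $0$ as neutral element). *)

(* Defs.v *)
From HB Require Import structures.
From mathcomp Require Import all_boot all_order all_algebra.
From mathcomp Require Import mpoly.
From mathcomp Require Import boolp classical_sets reals ereal Rstruct.

Set Implicit Arguments.
Unset Strict Implicit.
Unset Printing Implicit Defensive.
Import Order.TTheory GRing.Theory Num.Theory.
Local Open Scope ring_scope.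

Section Span.
Variables (R : pzRingType) (M : lmodType R).

Definition span (P : M -> Prop) : M -> Prop := fun x =>
  exists s : seq (R * M), (forall pv, List.In pv s -> P pv.2) /\
    x = \sum_(pv <- s) pv.1 *: pv.2.

Variable P : M -> Prop.

Definition spanb : {pred M} := fun x => `[< span P x >].

Lemma spanb_closed : subsemimod_closed spanb.
Proof.
split; [split|].
- by apply/asboolP; exists [::]; split => //; rewrite big_nil.
- move=> u v /asboolP[su [Hsu ->]] /asboolP[sv [Hsv ->]]; apply/asboolP.
  exists (su ++ sv); split; last by rewrite big_cat.
  move=> pv Hin; case: (List.in_app_or _ _ _ Hin); [exact: Hsu|exact: Hsv].
- move=> a u /asboolP[su [Hsu ->]]; apply/asboolP.
  exists [seq (a * pv.1, pv.2) | pv <- su]; split.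
    move=> pv /List.in_map_iff [pv' [Heq Hin]]; rewrite -Heq /=; exact: (Hsu _ Hin).
  rewrite big_map scaler_sumr; apply: eq_bigr => pv _; by rewrite scalerA.
Qed.

HB.instance Definition _ := GRing.isSubmodClosed.Build R M spanb spanb_closed.

Record subm := Subm { subm_val :> M; _ : subm_val \in spanb }.

HB.instance Definition _ := [isSub for subm_val].
HB.instance Definition _ := [Choice of subm by <:].
HB.instance Definition _ := [SubChoice_isSubLmodule of subm by <:].

End Span.

Definition is_linear (R : pzRingType) (M N : lmodType R) (f : M -> N) :=
  forall (a : R) (u v : M), f (a *: u + v) = a *: f u + f v.

Definition short_exact (R : pzRingType) (A B C : lmodType R)
  (f : A -> B) (g : B -> C) :=
  [/\ is_linear f, is_linear g, injective f, (forall c, exists b, g b = c) &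
      forall b, g b = 0 <-> exists a, b = f a].

Notation xreal := (\bar Rdefinitions.R).

Definition length_function (R : pzRingType)
    (lam : forall M : lmodType R, xreal) : Prop :=
  [/\ (forall M : lmodType R, (0 <= lam M)%E),
      (forall M : lmodType R, (forall x : M, x = 0) -> lam M = 0%E),
      (forall (M N : lmodType R) (f : M -> N), is_linear f -> bijective f ->
          lam M = lam N),
      (forall (A B C : lmodType R) (f : A -> B) (g : B -> C),
          short_exact f g -> lam B = (lam A + lam C)%E) &
      (forall M : lmodType R,
          lam M = ereal_sup [set lam (subm (fun x : M => List.In x s)) | s in
                              [set: seq M]])].

Definition is_ideal (R : comPzRingType) (I : R -> Prop) :=
  [/\ I 0, (forall x y, I x -> I y -> I (x + y)) & (forall a x, I x -> I (a * x))].

Definition noetherian (R : comPzRingType) :=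
  forall I : R -> Prop, is_ideal I ->
    exists s : seq R, forall x, I x <-> exists c : seq R,
        size c = size s /\ x = \sum_(i < size s) c`_i * s`_i.

Section Restriction.
Variables (R : comNzRingType) (k : nat) (N : lmodType {mpoly R[k]}).

Definition resR : Type := N.
HB.instance Definition _ := GRing.Zmodule.on resR.

Definition resR_scale (a : R) (v : resR) : resR := (a%:MP : {mpoly R[k]}) *: (v : N).

Lemma resR_scalerA a b (v : resR) :
  resR_scale a (resR_scale b v) = resR_scale (a * b) v.
Proof. by rewrite /resR_scale scalerA mpolyCM. Qed.

Lemma resR_scale1r : left_id 1 resR_scale.
Proof. by move=> v; rewrite /resR_scale mpolyC1 scale1r. Qed.

Lemma resR_scalerDr : right_distributive resR_scale +%R.
Proof. by move=> a u v; rewrite /resR_scale scalerDr. Qed.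

Lemma resR_scalerDl (v : resR) : {morph resR_scale^~ v : a b / a + b}.
Proof. by move=> a b; rewrite /resR_scale mpolyCD scalerDl. Qed.

HB.instance Definition _ := GRing.Zmodule_isLmodule.Build R resR
  resR_scalerA resR_scale1r resR_scalerDr resR_scalerDl.

End Restriction.

(* Monomials r t^d (with r in [0,+oo]) together with 0.               *)
Inductive mono := MZero | Mono of xreal & nat.

Definition mono_le (a b : mono) : Prop :=
  match a, b with
  | MZero, _ => True
  | Mono _ _, MZero => False
  | Mono r n, Mono s m => (n < m)%N \/ (n = m /\ (r <= s)%E)
  end.

Definition moplus (a b : mono) : mono :=
  match a, b with
  | MZero, b => b
  | a, MZero => a
  | Mono r n, Mono s m =>
      if (m < n)%N then Mono r n else if (n < m)%N then Mono s m
      else Mono (r + s)%E n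
  end.

Definition msup (I : set mono) : mono :=
  if `[< exists r d, I (Mono r d) >] then
    let d := xget 0%N [set d | (exists r, I (Mono r d)) /\
                               forall r' d', I (Mono r' d') -> (d' <= d)%N] in
    Mono (ereal_sup [set r | I (Mono r d)]) d
  else MZero.

Definition leadmono (q : {poly Rdefinitions.R}) : mono :=
  if q == 0 then MZero else Mono (lead_coef q)%:E (size q).-1.

Section SModules.
Variables (R : comNzRingType) (lam : forall M : lmodType R, xreal) (k : nat).
Variable N : lmodType {mpoly R[k]}.

Definition lamR (P : N -> Prop) : xreal := lam (subm (P : resR N -> Prop)).

Definition spanR (P : N -> Prop) : N -> Prop := @span R (resR N) P.
Definition spanS (P : N -> Prop) : N -> Prop := @span _ N P.

Definition is_Ssubmodule (P : N -> Prop) :=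
  P 0 /\ forall (a : {mpoly R[k]}) u v, P u -> P v -> P (a *: u + v).

Definition SnV (n : nat) (V : N -> Prop) : N -> Prop :=
  spanR (fun x => exists (p : {mpoly R[k]}) v,
                    [/\ (msize p <= n.+1)%N, V v & x = p *: v]).

Definition loc_finite (P : N -> Prop) :=
  forall v, P v -> (lamR (spanR (fun y => y = v)) < +oo)%E.

Definition small (P : N -> Prop) :=
  [/\ is_Ssubmodule P,
      (exists s : seq N, forall x, P x <-> spanS (fun y => List.In y s) x) &
      loc_finite P].

Definition is_mu (P : N -> Prop) (m : mono) :=
  exists g : seq N,
    let V0 := spanR (fun y => List.In y g) in
    [/\ (forall v, List.In v g -> P v),
        (lamR V0 < +oo)%E,
        (forall x, P x <-> spanS V0 x) &
        exists q : {poly Rdefinitions.R}, [/\ (size q <= k.+1)%N,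
          (exists n0, forall n, (n0 <= n)%N -> lamR (SnV n V0) = (q.[n%:R])%:E) &
          m = leadmono q]].

Definition mu : mono := msup [set m | exists P, small P /\ is_mu P m].

End SModules.

(* Main.v *)
Require Import Defs.
From HB Require Import structures.
From mathcomp Require Import all_boot all_order all_algebra.
From mathcomp Require Import mpoly.
From mathcomp Require Import boolp classical_sets reals ereal Rstruct.
From mathcomp Require Import zify.
From mathcomp Require polyrcf.

(** Fix generators [g_1, ..., g_r] of an R-module [V_0] in an S-module and order
    the terms [x^a g_i] by degree first. Adding the terms to the filtration
    [V_n = S_n V_0] one by one, each step contributes the length of the cyclic
    module [R / I_(a,i)], where [I_(a,i)] is the ideal of the [r] such that
    [r x^a g_i] is a combination of smaller terms. These ideals increase with
    [a] and [R] is Noetherian, so they depend on [a] only through its truncation at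
    some bound; summing over [|a| <= n] gives a polynomial for large [n].

    Leading coefficient ideals modulo an S-submodule [U], and division by
    finitely many elements realising them, give a finite [w] in [U] such that
    [V_n] meets [U] inside [S_n w] for every [n].

    In a short exact sequence the Hilbert polynomial of a generating set in [B]
    is therefore eventually at most the sum of Hilbert polynomials for [A] and [C];
    conversely, gathering generators from [A] with lifts of generators from [C]
    bounds such a sum by a Hilbert polynomial in [B]. Leading monomials of
    eventually nonnegative polynomials are monotone and turn sums into [moplus],
    and the suprema defining [mu] inherit both inequalities. *)

Set Implicit Arguments.
Unset Strict Implicit.
Unset Printing Implicit Defensive.
(* [Defs] is imported again because [vector] defines another [span]. *)
Import Order.TTheory GRing.Theory Num.Theory Defs.
Local Open Scope ring_scope.

(** * Spans, quotients and lengths *)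

Section SpanTheory.
Variables (R : pzRingType) (M : lmodType R).
Implicit Types (P Q : M -> Prop) (x y : M).

Definition is_submodule P := P 0 /\ forall a u v, P u -> P v -> P (a *: u + v).

Lemma in_spanb P x : x \in spanb P <-> span P x.
Proof. by split=> [/asboolP|?] //; apply/asboolP. Qed.

Lemma span_submodule P : is_submodule (span P).
Proof.
split=> [|a u v]; rewrite -!in_spanb; first exact: rpred0.
by move=> Pu Pv; rewrite rpredD ?rpredZ.
Qed.

Lemma mem_span P x : P x -> span P x.
Proof.
move=> Px; exists [:: (1, x)]; split=> [_ [<-|[]]|] //.
by rewrite big_seq1 scale1r.
Qed.

Lemma span_min P Q :
  is_submodule Q -> (forall x, P x -> Q x) -> forall x, span P x -> Q x.
Proof.
move=> [Q0 QD] PQ _ [s [sP ->]]; elim: s sP => [|[a u] s IHs] sP.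
  by rewrite big_nil.
rewrite big_cons; apply: QD => /=; first by apply: PQ; apply: (sP (a, u)); left.
by apply: IHs => pv pvs; apply: sP; right.
Qed.

Lemma span_mono P Q :
  (forall x, P x -> span Q x) -> forall x, span P x -> span Q x.
Proof. exact: span_min (span_submodule Q). Qed.

Lemma span_submod P x : is_submodule P -> span P x <-> P x.
Proof. by move=> Psub; split; [exact: span_min | exact: mem_span]. Qed.

Lemma span_span P x : span (span P) x <-> span P x.
Proof. exact: span_submod (span_submodule P). Qed.

Section Submodule.
Variables (P : M -> Prop) (Psub : is_submodule P).

Lemma submodD x y : P x -> P y -> P (x + y).
Proof. by move=> Px Py; rewrite -[x]scale1r; apply: Psub.2. Qed.

Lemma submodZ a x : P x -> P (a *: x).
Proof. by move=> Px; rewrite -[_ *: _]addr0; apply: Psub.2 Px Psub.1. Qed.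

Lemma submodB x y : P x -> P y -> P (x - y).
Proof. by move=> Px Py; rewrite -scaleN1r; apply/submodD/submodZ. Qed.

End Submodule.

Lemma span_adjoin P v x :
  span (fun y => P y \/ y = v) x -> exists a, span P (x - a *: v).
Proof.
have PS := span_submodule P.
apply: (span_min (Q := fun x => exists a, span P (x - a *: v))) => [|y].
  split=> [|c y z [a Ha] [b Hb]].
    by exists 0; rewrite scale0r subr0; apply: PS.1.
  exists (c * a + b); rewrite scalerDl opprD addrACA -scalerA -scalerBr.
  exact: PS.2.
case=> [Py|->].
  by exists 0; rewrite scale0r subr0; apply: mem_span.
by exists 1; rewrite scale1r subrr; apply: PS.1.
Qed.

End SpanTheory.

Section LinearMaps.
Variables (R : pzRingType) (M N : lmodType R) (f : M -> N).
Hypothesis f_lin : is_linear f.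

Lemma is_linear0 : f 0 = 0.
Proof. by rewrite -[in LHS](addNr 0) -scaleN1r f_lin scaleN1r addNr. Qed.

Lemma is_linearZ a x : f (a *: x) = a *: f x.
Proof. by rewrite -[_ *: x]addr0 f_lin is_linear0 addr0. Qed.

Lemma image_submodule (P : M -> Prop) : is_submodule P ->
  is_submodule (fun y => exists2 x, P x & y = f x).
Proof.
move=> PS; split=> [|a _ _ [x Px ->] [y Py ->]].
  by exists 0; [apply: PS.1 | rewrite is_linear0].
by exists (a *: x + y); [apply: PS.2 | rewrite f_lin].
Qed.

Lemma preimage_submodule (P : N -> Prop) : is_submodule P ->
  is_submodule (fun x => P (f x)).
Proof.
move=> PS; split=> [|a x y Px Py]; first by rewrite is_linear0; apply: PS.1.
by rewrite f_lin; apply: PS.2.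
Qed.

Lemma span_image (P : M -> Prop) x : span P x ->
  span (fun y => exists2 x, P x & y = f x) (f x).
Proof.
move: x; apply: span_min => [|x Px]; last by apply: mem_span; exists x.
exact: preimage_submodule (span_submodule _).
Qed.

End LinearMaps.

(** * Quotient modules *)

Section QuotientModule.
Variables (R : pzRingType) (M : lmodType R) (P : M -> Prop).

Local Notation quot := (Quotient.quot (spanb P)).
(** The quotient group under a new name, which then receives the R-module structure defined through
    representatives. *)
Definition quo : Type := quot.
HB.instance Definition _ := GRing.Zmodule.on quo.

Definition quo_proj (x : M) : quo := \pi_quot%qT x.
Definition quo_repr (u : quo) : M := repr (u : quot).

Lemma quo_reprK : cancel quo_repr quo_proj.
Proof. exact: reprK. Qed.

Lemma quo_projD : {morph quo_proj : x y / x + y}.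
Proof. by move=> x y; rewrite /quo_proj (raddfD (\pi_quot)%qT). Qed.

Lemma quo_proj_eq x y : quo_proj x = quo_proj y <-> span P (x - y).
Proof.
rewrite -in_spanb Quotient.idealrBE; split=> [H|/eqP //].
exact/eqP.
Qed.

Definition quo_scale (a : R) (u : quo) : quo := quo_proj (a *: quo_repr u).

(** Scaling does not depend on the representative: [x] and the chosen one differ by an element of
    the span, which is stable under [a]. The module laws then transfer from [M]. *)
Lemma quo_projZ a x : quo_proj (a *: x) = quo_scale a (quo_proj x).
Proof.
apply/quo_proj_eq; rewrite -scalerBr; apply: submodZ (span_submodule P) _ _ _.
by apply/quo_proj_eq; rewrite quo_reprK.
Qed.

Fact quo_scalerA a b u : quo_scale a (quo_scale b u) = quo_scale (a * b) u.
Proof. by rewrite -[u]quo_reprK -!quo_projZ scalerA. Qed.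

Fact quo_scale1r : left_id 1 quo_scale.
Proof. by move=> u; rewrite -[u]quo_reprK -!quo_projZ scale1r. Qed.

Fact quo_scalerDr : right_distributive quo_scale +%R.
Proof.
move=> a u v; rewrite -[u]quo_reprK -[v]quo_reprK -quo_projD -!quo_projZ.
by rewrite -quo_projD scalerDr.
Qed.

Fact quo_scalerDl (u : quo) : {morph quo_scale^~ u : a b / a + b}.
Proof.
by move=> a b; rewrite -[u]quo_reprK -!quo_projZ -quo_projD scalerDl.
Qed.

HB.instance Definition _ := GRing.Zmodule_isLmodule.Build R quo
  quo_scalerA quo_scale1r quo_scalerDr quo_scalerDl.

Lemma quo_proj_linear : is_linear quo_proj.
Proof. by move=> a u v; rewrite quo_projD quo_projZ. Qed.

Lemma quo_proj_eq0 x : quo_proj x = 0 <-> span P x.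
Proof.
by rewrite -(is_linear0 quo_proj_linear) quo_proj_eq subr0.
Qed.

End QuotientModule.

(** * Consequences of the axioms of a length function *)

Section LengthTheory.
Variables (R : comNzRingType) (lam : forall M : lmodType R, xreal).
Hypothesis lamP : length_function lam.

(** Since [subm] takes the span, [P] may be any generating set. *)
Definition len (M : lmodType R) (P : M -> Prop) : xreal := lam (subm P).

Lemma len_ge0 (M : lmodType R) (P : M -> Prop) : (0 <= len P)%E.
Proof. by case: lamP => ge0 _ _ _ _; apply: ge0. Qed.

Lemma subm_linear (M N : lmodType R) (P : M -> Prop) (Q : N -> Prop)
    (f : M -> N) (fPQ : forall x : subm P, f (subm_val x) \in spanb Q) :
  is_linear f -> is_linear (fun x : subm P => Subm (fPQ x)).
Proof. by move=> f_lin a u v; apply: val_inj; rewrite /= f_lin. Qed.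

Lemma len0 (M : lmodType R) (P : M -> Prop) :
  (forall x, P x -> x = 0) -> len P = 0%E.
Proof.
move=> P0; case: lamP => _ lam0 _ _ _; apply: lam0 => -[x xP].
apply: val_inj => /=; move/in_spanb: xP.
apply: (span_min (Q := fun x => x = 0)) => //.
by split=> // a u v -> ->; rewrite scaler0 addr0.
Qed.

Lemma len_eq (M : lmodType R) (P Q : M -> Prop) :
  (forall x, span P x <-> span Q x) -> len P = len Q.
Proof.
move=> PQ; case: lamP => _ _ iso _ _.
have PQ' (x : subm P) : subm_val x \in spanb Q.
  by apply/in_spanb/PQ/in_spanb; case: x.
have QP' (x : subm Q) : subm_val x \in spanb P.
  by apply/in_spanb/PQ/in_spanb; case: x.
apply: (iso _ _ (fun x => Subm (PQ' x))); first exact: (subm_linear (f := id)).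
by exists (fun x => Subm (QP' x)) => x; apply: val_inj.
Qed.

(** Kernel and image of [f] on [span P] are submodules, and with [span P] they form the short exact
    sequence required by the axiom. All later uses of additivity go through this form. *)
Lemma len_additive (M N : lmodType R) (f : M -> N) (P : M -> Prop) :
  is_linear f ->
  len P = (len (fun x => span P x /\ f x = 0)%R +
           len (fun y => exists2 x, span P x & y = f x))%E.
Proof.
move=> f_lin; case: lamP => _ _ _ add _; rewrite /len.
set K := (fun x => _ /\ _); set I := (fun y => _).
have Ksub : is_submodule K.
  split=> [|a u v [Pu fu] [Pv fv]].
    by split; [apply: (span_submodule P).1 | apply: is_linear0].
  by split; [apply: (span_submodule P).2 | rewrite f_lin fu fv scaler0 addr0].
have KP (x : subm K) : subm_val x \in spanb P.
  by case: x => x /= /in_spanb/(span_submod _ Ksub)[Px _]; apply/in_spanb.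
have PI (x : subm P) : f (subm_val x) \in spanb I.
  by apply/in_spanb/mem_span; exists (subm_val x) => //; apply/in_spanb; case: x.
apply: (add _ _ _ (fun x => Subm (KP x)) (fun x => Subm (PI x))); split.
- exact: (subm_linear (f := id)).
- exact: (subm_linear (f := f)).
- by move=> u v [uv]; apply: val_inj.
- case=> y yI; have /in_spanb := yI.
  move=> /(span_submod _ (image_submodule f_lin (span_submodule P)))[x xP yE].
  have xP' : x \in spanb P by apply/in_spanb.
  by exists (Subm xP'); apply: val_inj.
- move=> b; split=> [[fb]|[a ->]].
    have bK : subm_val b \in spanb K.
      by apply/in_spanb/mem_span; split=> //; apply/in_spanb; case: b {fb}.
    by exists (Subm bK); apply: val_inj.
  apply: val_inj => /=; case: a => a /= aK.
  by have /in_spanb/(span_submod _ Ksub)[] := aK.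
Qed.

(** On [span Q] the projection modulo [P] has kernel [span P], and the image has nonnegative
    length. *)
Lemma len_le (M : lmodType R) (P Q : M -> Prop) :
  (forall x, P x -> span Q x) -> (len P <= len Q)%E.
Proof.
move=> PQ; rewrite (len_additive Q (@quo_proj_linear _ _ P)).
rewrite -[X in (X <= _)%E]adde0; apply: leeD; last exact: len_ge0.
rewrite le_eqVlt; apply/orP; left; apply/eqP/len_eq => x.
split; apply: span_mono => {}x; last by case=> _ /quo_proj_eq0.
move=> Px; apply: mem_span; split; first exact: PQ.
exact/quo_proj_eq0/mem_span.
Qed.

Lemma len_image_le (M N : lmodType R) (f : M -> N) (P : M -> Prop) :
  is_linear f -> (len (fun y => exists2 x, span P x & y = f x) <= len P)%E.
Proof.
by move=> f_lin; rewrite (len_additive P f_lin) leeDr ?len_ge0.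
Qed.

Lemma len_image_inj (M N : lmodType R) (f : M -> N) (P : M -> Prop) :
  is_linear f -> (forall x, span P x -> f x = 0 -> x = 0) ->
  len P = len (fun y => exists2 x, span P x & y = f x).
Proof.
move=> f_lin f_inj; rewrite (len_additive P f_lin) len0 ?add0e //.
by move=> x [/f_inj].
Qed.

Definition cyclic_len (M : lmodType R) (v : M) := len (fun y => y = v).

Lemma span1 (M : lmodType R) (v x : M) :
  span (fun y => y = v) x <-> exists a, x = a *: v.
Proof.
split=> [|[a ->]]; last exact/(submodZ (span_submodule _))/mem_span.
move: x; apply: span_min => [|x ->]; last by exists 1; rewrite scale1r.
split=> [|c _ _ [a ->] [b ->]]; first by exists 0; rewrite scale0r.
by exists (c * a + b); rewrite scalerDl scalerA.
Qed.

(* Both cyclic modules are images of the one spanned by [(v, w)], and the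
   equality of annihilators makes the two projections injective on it. *)
Lemma cyclic_len_ann (M N : lmodType R) (v : M) (w : N) :
  (forall a, a *: v = 0 <-> a *: w = 0) -> cyclic_len v = cyclic_len w.
Proof.
move=> ann; pose p : (M * N)%type := (v, w).
have fst_lin : is_linear (fst : M * N -> M) by [].
have snd_lin : is_linear (snd : M * N -> N) by [].
transitivity (cyclic_len p); last first; [|symmetry].
  rewrite /cyclic_len (len_image_inj snd_lin).
    apply: len_eq => y; split; apply: span_mono => {}y.
      case=> x /span1[a ->] ->; apply/span1; by exists a.
    by move=> ->; apply: mem_span; exists p => //; apply: mem_span.
  by move=> x /span1[a ->] /= aw; congr pair => //=; apply/ann.
rewrite /cyclic_len (len_image_inj fst_lin).
  apply: len_eq => y; split; apply: span_mono => {}y.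
    case=> x /span1[a ->] ->; apply/span1; by exists a.
  by move=> ->; apply: mem_span; exists p => //; apply: mem_span.
by move=> x /span1[a ->] /= aw; congr pair => //=; apply/ann.
Qed.

(** The projection modulo [P], restricted to the enlarged span, has kernel [span P] and an image
    generated by the class of [v]. *)
Lemma len_adjoin (M : lmodType R) (P : M -> Prop) v :
  len (fun y => P y \/ y = v) = (len P + cyclic_len (quo_proj P v))%E.
Proof.
have lin := @quo_proj_linear _ _ P.
rewrite (len_additive _ lin); congr (_ + _)%E.
  apply: len_eq => x; split; last first.
    apply: span_mono => y Py; apply: mem_span; split.
      by apply: mem_span; left.
    exact/quo_proj_eq0/mem_span.
  by apply: span_mono => y [_ /quo_proj_eq0].
apply: len_eq => y; split; apply: span_mono => {}y.
  case=> x /span_adjoin[a /quo_proj_eq H] ->; apply/span1; exists a.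
  by rewrite H is_linearZ.
by move=> ->; apply: mem_span; exists v => //; apply: mem_span; right.
Qed.

(** The hypothesis equates the colon ideals [(P : v)] and [(Q : w)], which are the annihilators of
    the two classes. *)
Lemma cyclic_len_colon (M N : lmodType R) (P : M -> Prop) (Q : N -> Prop) v w :
  (forall a, span P (a *: v) <-> span Q (a *: w)) ->
  cyclic_len (quo_proj P v) = cyclic_len (quo_proj Q w).
Proof.
move=> H; apply: cyclic_len_ann => a.
rewrite -!(is_linearZ (@quo_proj_linear _ _ _)).
by split=> /quo_proj_eq0/H/quo_proj_eq0.
Qed.

Lemma cyclic_len_quo_le (M : lmodType R) (P : M -> Prop) v :
  (cyclic_len (quo_proj P v) <= cyclic_len v)%E.
Proof.
apply: le_trans (len_image_le _ (@quo_proj_linear _ _ P)).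
by apply: len_le => y ->; apply: mem_span; exists v => //; apply: mem_span.
Qed.

End LengthTheory.

(** * Monotone families of ideals and eventually polynomial sums *)

Section MonotoneFamilies.
Variables (T : Type) (D : T -> Prop) (le : T -> T -> Prop).

(** Stationarity is one-sided, the other comparison being monotonicity; ideals given as predicates
    thus need only inclusion, not equality. *)
Definition ascending_chain_condition := forall u : nat -> T,
  (forall n, D (u n)) -> (forall m n, (m <= n)%N -> le (u m) (u n)) ->
  exists n0, forall n, (n0 <= n)%N -> le (u n) (u n0).

Hypothesis le_trans : forall x y z, le x y -> le y z -> le x z.
Hypothesis acc : ascending_chain_condition.

Lemma all2_leq_refl a : all2 leq a a.
Proof. by elim: a => //= i a ->; rewrite leqnn. Qed.

(* The chain [n |-> u n (n :: _)] stabilises at some [n0]; beyond it only the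
   finitely many chains [u _ (j :: _)] with [j < n0] are left to control. *)
Lemma acc_families k (u : nat -> seq nat -> T) :
  (forall n a, D (u n a)) ->
  (forall m n a b, (m <= n)%N -> size a = k -> all2 leq a b ->
     le (u m a) (u n b)) ->
  exists n0, forall n a, (n0 <= n)%N -> size a = k -> le (u n a) (u n0 a).
Proof.
elim: k u => [|k IHk] u Du u_mono.
  have [//|m n mn|n0 n0P] := acc (u := fun n => u n [::]).
    exact: u_mono.
  by exists n0 => n [|//] n0n _; apply: n0P.
have [//||n0 n0P] := IHk (fun n a => u n (n :: a)).
  by move=> m n a b mn sa ab; apply: u_mono; rewrite /= ?mn ?sa.
have [N NP] : exists N, forall j n a, (j < n0)%N -> (N <= n)%N -> size a = k ->
    le (u n (j :: a)) (u N (j :: a)).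
  elim: n0 {n0P} => [|m [N NP]]; first by exists 0%N.
  have [//||N' N'P] := IHk (fun n a => u n (m :: a)).
    by move=> i n a b mn sa ab; apply: u_mono; rewrite //= ?sa ?leqnn.
  exists (maxn N N') => j n a; rewrite ltnS leq_eqVlt geq_max.
  move=> /predU1P[->|jm] /andP[Nn N'n] sa.
    apply: le_trans (N'P _ _ N'n sa) _; apply: u_mono; rewrite /= ?sa //.
      exact: leq_maxr.
    by rewrite leqnn all2_leq_refl.
  apply: le_trans (NP _ _ _ jm Nn sa) _; apply: u_mono; rewrite /= ?sa //.
    exact: leq_maxl.
  by rewrite leqnn all2_leq_refl.
exists (maxn n0 N) => n [//|j a]; rewrite geq_max => /andP[n0n Nn] [sa].
have [jn0|n0j] := ltnP j n0.
  apply: le_trans (NP _ _ _ jn0 Nn sa) _; apply: u_mono; rewrite /= ?sa //.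
    exact: leq_maxr.
  by rewrite leqnn all2_leq_refl.
have n0m : (n0 <= maxn n j)%N by rewrite leq_max n0n.
apply: (le_trans (y := u (maxn n j) (maxn n j :: a))).
  apply: u_mono; rewrite /= ?sa ?leq_maxl //.
  by rewrite leq_maxr all2_leq_refl.
apply: le_trans (n0P _ _ n0m sa) _; apply: u_mono; rewrite /= ?sa ?leq_maxl //.
by rewrite n0j all2_leq_refl.
Qed.

Section Family.
Variables (k : nat) (F : seq nat -> T).
Hypothesis F_D : forall a, D (F a).
Hypothesis F_mono : forall a b, size a = k.+1 -> all2 leq a b -> le (F a) (F b).

(** The gain is uniformity: a single [n0] serves all tails [a]. *)
Lemma head_stable : exists n0, forall n a, (n0 <= n)%N -> size a = k ->
  le (F (n :: a)) (F (n0 :: a)).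
Proof.
apply: acc_families => // m n a b mn sa ab.
by apply: F_mono; rewrite /= ?sa ?mn.
Qed.
End Family.

(** A form of Dickson's lemma. Heads beyond the stable value [n0] reduce to [n0]; each of the
    finitely many heads up to [n0] has a basis by induction on [k]. *)
Lemma finite_basis k (F : seq nat -> T) :
  (forall a, D (F a)) ->
  (forall a b, size a = k -> all2 leq a b -> le (F a) (F b)) ->
  exists Bs : seq (seq nat), forall a, size a = k ->
    exists b, [/\ b \in Bs, all2 leq b a & le (F a) (F b)].
Proof.
elim: k F => [|k IHk] F FD F_mono.
  exists [:: [::]] => -[|//] _; exists [::]; split=> //; exact: F_mono.
have [n0 n0P] := head_stable FD F_mono.
have [Bs BsP] : exists Bs : seq (seq nat), forall j a, (j < n0.+1)%N ->
    size a = k ->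
    exists b, [/\ b \in Bs, all2 leq b (j :: a) & le (F (j :: a)) (F b)].
  elim: n0.+1 => [|m [Bs BsP]]; first by exists [::].
  have [//||Bs' Bs'P] := IHk (fun a => F (m :: a)).
    by move=> a b sa ab; apply: F_mono; rewrite /= ?sa ?leqnn.
  exists (Bs ++ map (cons m) Bs') => j a; rewrite ltnS leq_eqVlt.
  move=> /predU1P[->|jm] sa.
    have [b [bB ba Fb]] := Bs'P _ sa; exists (m :: b); split=> //.
      by rewrite mem_cat map_f ?orbT.
    by rewrite /= leqnn.
  by have [b [bB ba Fb]] := BsP _ _ jm sa; exists b; rewrite mem_cat bB.
exists Bs => -[//|j a] [sa]; have [jn0|n0j] := ltnP j n0.+1; first exact: BsP.
have [b [bB ba Fb]] := BsP n0 a (leqnn _) sa; exists b; split=> //.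
  case: b ba {bB Fb} => //= i b /andP[in0 ->].
  by rewrite (leq_trans in0) // ltnW.
by apply: le_trans (n0P _ _ (ltnW n0j) sa) Fb.
Qed.

End MonotoneFamilies.

(** * Functions that eventually agree with a polynomial *)

Section EventuallyPolynomial.
Variable K : numFieldType.
Implicit Types (d : nat) (G : nat -> K) (q : {poly K}).

Definition evpoly d G := exists q, (size q <= d.+1)%N /\
  exists n0, forall n, (n0 <= n)%N -> G n = q.[n%:R].

Lemma evpoly_eq d G G' n0 :
  (forall n, (n0 <= n)%N -> G n = G' n) -> evpoly d G' -> evpoly d G.
Proof.
move=> GG' [q [sq [n1 n1P]]]; exists q; split=> //; exists (maxn n0 n1) => n.
by rewrite geq_max => /andP[/GG' -> /n1P].
Qed.

Lemma evpoly0 d : evpoly d (fun=> 0).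
Proof.
by exists 0; split; [rewrite size_poly0 | exists 0%N => n; rewrite horner0].
Qed.

Lemma evpolyD d G G' : evpoly d G -> evpoly d G' ->
  evpoly d (fun n => G n + G' n).
Proof.
move=> [q [sq [n0 n0P]]] [q' [sq' [n1 n1P]]]; exists (q + q'); split.
  by apply: leq_trans (size_polyD _ _) _; rewrite geq_max sq.
exists (maxn n0 n1) => n; rewrite geq_max hornerD => /andP[/n0P -> /n1P ->].
by [].
Qed.

Lemma evpoly_sum d I (s : seq I) (G : I -> nat -> K) :
  (forall i, evpoly d (G i)) -> evpoly d (fun n => \sum_(i <- s) G i n).
Proof.
move=> GP; elim: s => [|i s IHs].
  by apply: (evpoly_eq (n0 := 0%N)) (evpoly0 d) => n _; rewrite big_nil.
apply: (evpoly_eq (n0 := 0%N)) (evpolyD (GP i) IHs) => n _.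
by rewrite big_cons.
Qed.

Lemma evpolyS d G : evpoly d G -> evpoly d.+1 G.
Proof. by move=> [q [sq qP]]; exists q; split=> //; apply: leqW. Qed.

Lemma evpoly_shift d G j : evpoly d G -> evpoly d (fun n => G (n - j)%N).
Proof.
move=> [q [sq [n0 n0P]]]; exists (q \Po ('X - j%:R%:P)); split.
  by rewrite size_comp_poly2 // size_XsubC.
(* From here on the truncated subtraction [n - j] is the true one. *)
exists (n0 + j)%N => n n0n.
rewrite n0P ?leq_subRL ?(leq_trans (leq_addl _ _) n0n) 1?addnC //.
rewrite horner_comp !hornerE natrB //.
exact: leq_trans (leq_addl _ _) n0n.
Qed.

Lemma antidifference d q : (size q <= d)%N ->
  exists Q : {poly K}, (size Q <= d.+1)%N /\ Q \Po ('X + 1) - Q = q.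
Proof.
elim: d q => [|d IHd] q sq.
  exists 0; split; first by rewrite size_poly0.
  by rewrite comp_poly0 subr0; apply/esym/eqP; rewrite -size_poly_leq0.
(* [E] is the difference of [X^(d+1)]; it has degree [d] and leading coefficient [d+1], invertible
   in characteristic zero. Subtracting [c *: E] removes the coefficient of [X^d] from [q]. *)
pose E : {poly K} := ('X + 1) ^+ d.+1 - 'X^(d.+1).
have EE j : E`_j = if (j < d.+1)%N then 'C(d.+1, j)%:R else 0.
  rewrite coefB coefXn exprD1n.
  under eq_bigr do rewrite -mulr_natl -polyC_natr mul_polyC.
  rewrite -(poly_def d.+2 (fun i => 'C(d.+1, i)%:R)) coef_poly ltnS.
  case: ltngtP => [|_|->]; rewrite ?subr0 ?subrr //.
  by rewrite binn subrr.
pose c := q`_d / d.+1%:R.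
have [|Q [sQ QE]] := IHd (q - c *: E).
  apply/leq_sizeP => j; rewrite coefB coefZ EE ltnS leq_eqVlt.
  move=> /predU1P[<-|dj].
    by rewrite leqnn binSn divfK ?subrr // pnatr_eq0.
  rewrite leqNgt dj mulr0 subr0; move/leq_sizeP: sq; exact.
exists (Q + c *: 'X^(d.+1)); split.
  apply: leq_trans (size_polyD _ _) _; rewrite geq_max leqW //=.
  by apply: leq_trans (size_scale_leq _ _) _; rewrite size_polyXn.
rewrite comp_polyD comp_polyZ comp_Xn_poly opprD addrACA QE.
by rewrite -scalerBr subrK.
Qed.

Lemma evpoly_psum d G : evpoly d G ->
  evpoly d.+1 (fun n => \sum_(0 <= i < n.+1) G i).
Proof.
move=> [q [sq [n0 n0P]]]; have [Q [sQ QE]] := antidifference sq.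
(* The sum from [n0] on telescopes to [Q(n+1) - Q(n0)]; the constant [c] also accounts for the
   initial terms, where [G] need not be polynomial. *)
pose c := \sum_(0 <= i < n0) G i - Q.[n0%:R].
exists (Q \Po ('X + 1) + c%:P); split.
  apply: leq_trans (size_polyD _ _) _; rewrite geq_max.
  rewrite size_comp_poly2 ?size_XaddC // sQ /=.
  by apply: leq_trans (size_polyC_leq1 _) _.
exists n0 => n n0n; rewrite (@big_cat_nat _ _ _ n0) ?leqW //=.
rewrite [X in _ + X](eq_big_nat _ _ (F2 := fun i => Q.[i.+1%:R] - Q.[i%:R])).
  rewrite telescope_sumr ?leqW // /c hornerD horner_comp !hornerE natr1.
  by rewrite /= [in RHS](addrC Q.[_]).
move=> i /andP[n0i _]; rewrite n0P // -QE hornerD hornerN horner_comp !hornerE.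
by rewrite natr1.
Qed.

End EventuallyPolynomial.

(** Multi-indices are sliced along the first entry, to match the induction on [k] for sums over
    them. *)
Fixpoint box (k n : nat) : seq (seq nat) :=
  if k is k'.+1 then [seq j :: a | j <- iota 0 n.+1, a <- box k' (n - j)]
  else [:: [::]].

Lemma boxS k n :
  box k.+1 n = [seq j :: a | j <- iota 0 n.+1, a <- box k (n - j)].
Proof. by []. Qed.

Lemma mem_box k n a : (a \in box k n) = (size a == k) && (sumn a <= n)%N.
Proof.
elim: k n a => [|k IHk] n [|i a] //; rewrite boxS.
  by apply/allpairsPdep => -[x [y []]].
rewrite [size _]/= [sumn _]/= eqSS; apply/allpairsPdep/idP => [[x [y [xn yb [-> ->]]]]|].
  move: yb xn; rewrite IHk mem_iota add0n ltnS => /andP[-> ?] xn.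
  by rewrite -leq_subRL.
case/andP=> sa ian; exists i, a; rewrite mem_iota add0n ltnS IHk sa.
have i_n : (i <= n)%N by apply: leq_trans ian; apply: leq_addr.
by split=> //; rewrite leq_subRL.
Qed.

Lemma box_uniq k n : uniq (box k n).
Proof.
elim: k n => // k IHk n; rewrite boxS; apply: allpairs_uniq_dep => [|x _|] //.
  exact: iota_uniq.
by move=> [i a] [j b] _ _ /= [-> ->].
Qed.

(** The slice of head [j] contributes [G j (n - j)]. The slices with [j < n0] are finitely many
    shifts of functions of degree at most [k]; from [n0] on all [G j] equal [G n0], so the rest is a
    partial sum of [G n0], which raises the degree bound by one. *)
Lemma evpoly_box (K : numFieldType) (T : Type) (D : T -> Prop) le k
    (F : seq nat -> T) (f : seq nat -> K) :
  (forall x y z, le x y -> le y z -> le x z) ->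
  ascending_chain_condition D le ->
  (forall a, D (F a)) ->
  (forall a b, size a = k -> all2 leq a b -> le (F a) (F b)) ->
  (forall a b, size a = k -> size b = k -> le (F a) (F b) -> le (F b) (F a) ->
    f a = f b) ->
  evpoly k (fun n => \sum_(a <- box k n) f a).
Proof.
move=> le_tr acc; elim: k F f => [|k IHk] F f FD F_mono fF.
  exists (f [::])%:P; split; first exact: size_polyC_leq1.
  by exists 0%N => n _; rewrite big_seq1 hornerC.
have [n0 n0P] := head_stable le_tr acc FD F_mono.
pose G j m := \sum_(a <- box k m) f (j :: a).
have GP j : evpoly k (G j).
  apply: (IHk (fun a => F (j :: a))) => // [a b sa ab|a b sa sb].
    by apply: F_mono; rewrite /= ?sa ?leqnn.
  by apply: fF; rewrite /= ?sa ?sb.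
have Gn0 j m : (n0 <= j)%N -> G j m = G n0 m.
  move=> n0j; apply: eq_big_seq => a; rewrite mem_box => /andP[/eqP sa _].
  apply: fF; rewrite /= ?sa //; first exact: n0P.
  by apply: F_mono; rewrite /= ?sa // n0j all2_leq_refl.
apply: (evpoly_eq (n0 := n0) (G' := fun n =>
  \sum_(0 <= j < n0) G j (n - j)%N + \sum_(0 <= i < (n - n0).+1) G n0 i));
  last apply: evpolyD.
- move=> n n0n; rewrite boxS big_allpairs_dep -/(index_iota 0 n.+1).
  rewrite (@big_cat_nat _ _ _ n0) ?leqW //=.
  rewrite [X in _ + X](eq_big_nat _ _ (F2 := fun j => G n0 (n - j)%N)); last first.
    by move=> j /andP[n0j _]; apply: Gn0.
  rewrite [X in _ + X]big_nat_rev /= -[X in \sum_(X <= i < n.+1) _]add0n big_addn; congr (_ + _).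
  rewrite subSn //; apply: eq_big_nat => i /andP[_ i_n]; congr (G _ _).
  lia.
- apply: evpolyS; apply: (@evpoly_sum _ _ _ _ (fun j n => G j (n - j)%N)) => j.
  exact: evpoly_shift.
- exact: (@evpoly_shift _ _ (fun m => \sum_(0 <= i < m.+1) G n0 i) _ (evpoly_psum _)).
Qed.

(** * Monomials *)

Section MonomialOrder.

(** The type [mono] also contains negative coefficients; this singles out the intended monomials. *)
Definition mono_ge0 (m : mono) : Prop :=
  if m is Mono r _ then (0 <= r)%E else True.

Lemma mono_le_refl m : mono_le m m.
Proof. by case: m => //= r d; right. Qed.

Lemma mono_le_trans m1 m2 m3 : mono_le m1 m2 -> mono_le m2 m3 -> mono_le m1 m3.
Proof.
case: m1 m2 m3 => [|r1 d1] [|r2 d2] [|r3 d3] //=.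
case=> [lt12|[-> le12]] [lt23|[<- le23]]; try by left.
- by left; apply: ltn_trans lt23.
- by right; split=> //; apply: le_trans le23.
Qed.

Lemma mono_le_anti m1 m2 : mono_le m1 m2 -> mono_le m2 m1 -> m1 = m2.
Proof.
case: m1 m2 => [|r1 d1] [|r2 d2] //=.
case=> [lt12|[-> le12]] [lt21|[e le21]]; try lia.
by congr Mono; apply: le_anti; rewrite le12.
Qed.

(** Nonnegativity serves when [n1] and [n2] have equal degree but only one of [m1], [m2] reaches it:
    the additional coefficient must not decrease the sum. *)
Lemma moplus_mono m1 m2 n1 n2 : mono_ge0 n1 -> mono_ge0 n2 ->
  mono_le m1 n1 -> mono_le m2 n2 -> mono_le (moplus m1 m2) (moplus n1 n2).
Proof.
case: m1 m2 n1 n2 => [|r1 d1] [|r2 d2] [|s1 e1] [|s2 e2] //= s10 s20.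
- move=> _ h; case: ltngtP => /= h'; try by case: h => [?|[? ?]]; left; lia.
    exact: h.
  case: h => [?|[-> le]]; [by left; lia | right; split=> //].
  by apply: le_trans le _; rewrite leeDr.
- move=> h _; case: ltngtP => /= h'; try by case: h => [?|[? ?]]; left; lia.
    exact: h.
  case: h => [?|[-> le]]; [by left; lia | right; split=> //].
  by apply: le_trans le _; rewrite leeDl.
case=> [lt1|[-> le1]] [lt2|[-> le2]]; case: (ltngtP e1 e2) => h1;
  rewrite ?h1 ?ltnn; do ?case: ltngtP => h2 /=; try by left; lia.
all: try by right.
all: try lia.
- by right; split=> //; apply: le_trans le2 _; rewrite leeDr.
- by right; split=> //; apply: le_trans le1 _; rewrite leeDl.
- by right; split=> //; apply: leeD.
Qed.

Variable k : nat.
Definition mono_deg_le (m : mono) : Prop :=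
  if m is Mono _ d then (d <= k)%N else True.

Variant msup_spec (I : set mono) : mono -> Prop :=
  | MsupZero of (forall r d, ~ I (Mono r d)) : msup_spec I MZero
  | MsupMono r d of I (Mono r d) & (forall r' d', I (Mono r' d') -> (d' <= d)%N) :
      msup_spec I (Mono (ereal_sup [set r | I (Mono r d)]) d).

(** The bound [k] on degrees makes a maximal degree exist, so [xget] does not fall back on its
    default value. *)
Lemma msupP (I : set mono) :
  (forall m, I m -> mono_deg_le m) -> msup_spec I (msup I).
Proof.
move=> Ik; rewrite /msup; case: asboolP => [[r0 [d0 I0]]|I0]; last first.
  by apply: MsupZero => r d Ird; apply: I0; exists r, d.
set E := (X in xget _ X).
have [d [[r Ird] dmax]] : exists d, E d.
  pose P d := `[< exists r, I (Mono r d) >].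
  have exP : exists d, P d by exists d0; apply/asboolP; exists r0.
  have ubP d : P d -> (d <= k)%N by move=> /asboolP[r /Ik].
  case: (ex_maxnP exP ubP) => d /asboolP[r Ird] dmax; exists d; split.
    by exists r.
  by move=> r' d' Id'; apply: dmax; apply/asboolP; exists r'.
case: xgetP => [_ -> [[r' Ir'] d'max]|/(_ d) []]; last by split=> //; exists r.
exact: MsupMono Ir' d'max.
Qed.

Lemma msup_ub (I : set mono) m :
  (forall m, I m -> mono_deg_le m) -> I m -> mono_le m (msup I).
Proof.
move=> /msupP; case=> [I0|r d Ird dmax]; case: m => [|r' d'] //= Im.
  exact: I0 Im.
have := dmax _ _ Im; rewrite leq_eqVlt => /predU1P[e|]; last by left.
by right; split=> //; apply: ereal_sup_ubound; rewrite /= -e.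
Qed.

Lemma msup_le (I : set mono) x : (forall m, I m -> mono_deg_le m) ->
  (forall m, I m -> mono_le m x) -> mono_le (msup I) x.
Proof.
move=> /msupP; case=> [|r d Ird dmax Ix] //; case: x Ix => [|s e] Ix.
  exact: Ix Ird.
have [lt|le] := ltnP d e; [by left | right].
have {}le : d = e by case: (Ix _ Ird) => [|[]//]; lia.
split=> //; apply: ge_ereal_sup => r' /= /Ix[|[]//]; lia.
Qed.

Lemma msup_ge0 (I : set mono) : (forall m, I m -> mono_deg_le m) ->
  (forall m, I m -> mono_ge0 m) -> mono_ge0 (msup I).
Proof.
move=> /msupP; case=> //= r d Ird _ I0; apply: le_trans (I0 _ Ird) _.
exact: ereal_sup_ubound.
Qed.

(** For real [s], nonnegativity makes all terms finite, so one summand can be moved across the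
    inequality while the supremum over the other is taken. *)
Lemma ereal_supD_le (X Y : set xreal) s :
  (forall x, X x -> 0 <= x)%E -> (forall y, Y y -> 0 <= y)%E ->
  (forall x y, X x -> Y y -> x + y <= s)%E -> (X !=set0)%classic -> (Y !=set0)%classic ->
  (ereal_sup X + ereal_sup Y <= s)%E.
Proof.
move=> X0 Y0 XY [x Xx] [y Yy].
case: s XY => [s| |] XY; last 2 first.
- exact: leey.
- have := XY _ _ Xx Yy; rewrite leeNy_eq => /eqP e.
  by have := adde_ge0 (X0 _ Xx) (Y0 _ Yy); rewrite e.
have Xfin x' : X x' -> x' \is a fin_num.
  move=> Xx'; rewrite ge0_fin_numE ?X0 //; apply: le_lt_trans (ltry s).
  by apply: le_trans (XY _ _ Xx' Yy); rewrite leeDl ?Y0.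
have Yle x' : X x' -> (ereal_sup Y <= s%:E - x')%E.
  move=> Xx'; apply: ge_ereal_sup => y' Yy'.
  by rewrite leeBrDl ?Xfin // XY.
have Yfin : ereal_sup Y \is a fin_num.
  rewrite ge0_fin_numE; last first.
    by apply: le_trans (Y0 _ Yy) _; apply: ereal_sup_ubound.
  apply: le_lt_trans (Yle _ Xx) _.
  by move/Xfin: Xx; case: x => // x _; rewrite -EFinB ltry.
rewrite -leeBrDr //; apply: ge_ereal_sup => x' Xx'.
by rewrite leeBrDr // -leeBrDl ?Xfin // Yle.
Qed.

(** Each supremum alone lies below [x], because [m] and [n] lie below [moplus m n] and both sets are
    inhabited. This settles distinct degrees; for equal degrees the coefficients add and
    [ereal_supD_le] applies. *)
Lemma moplus_msup_le (I J : set mono) x :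
  (forall m, I m -> mono_deg_le m) -> (forall m, J m -> mono_deg_le m) ->
  (forall m, I m -> mono_ge0 m) -> (forall m, J m -> mono_ge0 m) ->
  (I !=set0)%classic -> (J !=set0)%classic ->
  (forall m n, I m -> J n -> mono_le (moplus m n) x) ->
  mono_le (moplus (msup I) (msup J)) x.
Proof.
move=> Ik Jk I0 J0 [m0 Im0] [n0 Jn0] IJ.
have leI : mono_le (msup I) x.
  apply: msup_le => // m Im; apply: mono_le_trans (IJ _ _ Im Jn0).
  case: m n0 Im Jn0 => [|r d] [|s e] // /I0 r0 /J0 s0; first by right.
  rewrite /moplus; case: (ltngtP d e) => de; [by left | exact: mono_le_refl |].
  by right; rewrite leeDl.
have leJ : mono_le (msup J) x.
  apply: msup_le => // n Jn; apply: mono_le_trans (IJ _ _ Im0 Jn).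
  case: m0 n Im0 Jn => [|r d] [|s e] // /I0 r0 /J0 s0; first by right.
  rewrite /moplus; case: (ltngtP d e) => de; [exact: mono_le_refl | by left |].
  by right; rewrite leeDr // de.
move: leI leJ; case: (msupP Ik) => [_|r d Ird _]; first by [].
case: (msupP Jk) => [_|s e Jse _]; first by [].
rewrite /moplus; case: (ltngtP d e) => // de _ _; rewrite -de in Jse *.
have IJd r' s' : I (Mono r' d) -> J (Mono s' d) -> mono_le (Mono (r' + s')%E d) x.
  by move=> Ir Js; have := IJ _ _ Ir Js; rewrite /= ltnn.
case: x {IJ} IJd => [|t e'] IJd; first exact: IJd Ird Jse.
have [lt|le] := ltnP d e'; [by left | right].
have {}le : d = e' by case: (IJd _ _ Ird Jse) => [|[]//]; lia.
split=> //; apply: ereal_supD_le => [r' /I0|s' /J0|r' s' Ir Js||] //.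
- by case: (IJd _ _ Ir Js) => [|[]//]; lia.
- by exists r.
- by exists s.
Qed.

End MonomialOrder.

(** * Leading monomials of eventually nonnegative polynomials *)

Section LeadingMonomial.
Local Notation K := Rdefinitions.R.
Implicit Types p q : {poly K}.

Definition ev_ge0 p := exists n0, forall n, (n0 <= n)%N -> 0 <= p.[n%:R].

(** If the leading coefficient were negative, [-p] would be bounded below by a positive constant
    from some real [x] on, hence at a large integer. *)
Lemma ev_ge0_lead p : ev_ge0 p -> 0 <= lead_coef p.
Proof.
move=> [n0 n0P]; rewrite leNgt; apply/negP => lp.
have := @polyrcf.poly_pinfty_gt_lc _ (- p).
rewrite lead_coefN oppr_gt0 => /(_ lp)[x xP].
pose n := maxn n0 (Num.bound `|x|).
have xn : x <= n%:R.
  apply: le_trans (ler_norm _) _; apply: ltW; apply: lt_le_trans (archi_boundP _) _.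
    exact: normr_ge0.
  by rewrite ler_nat; apply: leq_maxr.
have := xP _ xn; rewrite hornerN lerN2 leNgt (lt_le_trans lp) //.
by apply: n0P; apply: leq_maxl.
Qed.

Lemma leadmono_ge0 p : ev_ge0 p -> mono_ge0 (leadmono p).
Proof. by move=> /ev_ge0_lead lp; rewrite /leadmono; case: ifP => //= _; rewrite lee_fin. Qed.

Lemma leadmono_deg k p : (size p <= k.+1)%N -> mono_deg_le k (leadmono p).
Proof. by rewrite /leadmono; case: ifP => //= _; case: size. Qed.

(** A smaller degree of [q], or an equal degree with a smaller coefficient, would make the leading
    coefficient of [q - p] negative. *)
Lemma leadmono_le p q : ev_ge0 p -> ev_ge0 (q - p) -> mono_le (leadmono p) (leadmono q).
Proof.
move=> p0 qp; rewrite /leadmono; case: ifPn => // pn0.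
have lp : 0 < lead_coef p by rewrite lt0r lead_coef_eq0 pn0 ev_ge0_lead.
have := ev_ge0_lead qp.
have [sqp|spq|spq] := ltngtP (size q) (size p).
- by rewrite lead_coefDr ?size_polyN // lead_coefN oppr_ge0 leNgt lp.
- have qn0 : q != 0 by rewrite -size_poly_gt0 (leq_trans _ spq).
  by rewrite (negbTE qn0) /=; left; rewrite -ltnS !prednK ?size_poly_gt0.
have qn0 : q != 0 by rewrite -size_poly_gt0 spq size_poly_gt0.
rewrite (negbTE qn0) /= spq => _; right; split=> //; rewrite lee_fin leNgt.
apply/negP => lt.
have c : (q - p)`_(size p).-1 < 0 by rewrite coefB -{1}spq subr_lt0.
have := ev_ge0_lead qp; rewrite leNgt => /negP; apply.
suff sqp : size (q - p) = size p by rewrite lead_coefE sqp.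
apply/eqP; rewrite eqn_leq; apply/andP; split.
  by apply: leq_trans (size_polyD _ _) _; rewrite size_polyN spq maxnn.
rewrite leqNgt; apply/negP => sz; move: c; rewrite nth_default ?ltxx //.
by rewrite -ltnS prednK // size_poly_gt0.
Qed.

(** Nonzero summands have positive leading coefficients, so the leading terms cannot cancel. *)
Lemma leadmonoD p q : ev_ge0 p -> ev_ge0 q ->
  leadmono (p + q) = moplus (leadmono p) (leadmono q).
Proof.
move=> /ev_ge0_lead lp /ev_ge0_lead lq; rewrite /leadmono.
have [->|pn0] := eqVneq p 0; first by rewrite add0r.
have [->|qn0] := eqVneq q 0; first by rewrite addr0 (negbTE pn0).
have sp := pn0; have sq := qn0; rewrite -!size_poly_gt0 in sp sq.
rewrite /moplus; have [lt|lt|eq] := ltngtP (size q) (size p).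
- rewrite -size_poly_eq0 size_polyDl // size_poly_eq0 (negbTE pn0).
  by rewrite lead_coefDl // ifT //; move: sp sq lt; do 2!case: size.
- rewrite -size_poly_eq0 addrC size_polyDl // size_poly_eq0 (negbTE qn0).
  rewrite lead_coefDl // ifF ?ifT //; move: sp sq lt; do 2!case: size => //=; lia.
have c : 0 < (p + q)`_(size p).-1.
  by rewrite coefD -{2}eq addr_gt0 // lt0r lead_coef_eq0 ?pn0 ?qn0.
have s : size (p + q) = size p.
  apply/eqP; rewrite eqn_leq; apply/andP; split.
    by apply: leq_trans (size_polyD _ _) _; rewrite eq maxnn.
  rewrite leqNgt; apply/negP => sz; move: c; rewrite nth_default ?ltxx //.
  by rewrite -ltnS prednK.
rewrite -size_poly_eq0 s size_poly_eq0 (negbTE pn0) eq ltnn.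
by rewrite !lead_coefE s coefD eq.
Qed.

End LeadingMonomial.

(** * Downward closed sets of terms *)

Lemma List_InE (T : eqType) (x : T) (s : seq T) : List.In x s <-> x \in s.
Proof.
elim: s => //= y s IHs; rewrite inE; split=> [[->|/IHs ->]|/predU1P[->|/IHs]].
- by rewrite eqxx.
- by rewrite orbT.
- by left.
- by right.
Qed.

(** The union of the chain is an ideal; its finitely many generators all lie in one member. *)
Lemma noetherian_acc (R : comNzRingType) : noetherian R ->
  ascending_chain_condition (@is_ideal R) (fun I J => forall x, I x -> J x).
Proof.
move=> noeth u u_ideal u_mono.
pose I x := exists n, u n x.
have [|s sP] := noeth I.
  split=> [|x y [m um] [n un]|a x [n un]].
  - by exists 0%N; case: (u_ideal 0%N).
  - exists (maxn m n); case: (u_ideal (maxn m n)) => _ D _; apply: D.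
      exact: u_mono (leq_maxl _ _) _ um.
    exact: u_mono (leq_maxr _ _) _ un.
  - by exists n; case: (u_ideal n) => _ _; apply.
have sI j : (j < size s)%N -> I s`_j.
  (* A generator is the combination of all generators with Kronecker delta coefficients. *)
  move=> js; apply/sP; exists (mkseq (fun i => (i == j)%:R) (size s)).
  rewrite size_mkseq; split=> //.
  rewrite (bigD1 (Ordinal js)) //= nth_mkseq // eqxx mul1r big1 ?addr0 //.
  by move=> i ij; rewrite nth_mkseq // (negbTE (ij : val i != j)) mul0r.
have [n0 n0P] : exists n0, forall j, (j < size s)%N -> u n0 s`_j.
  elim: (size s) sI => [|m IHm] sI; first by exists 0%N.
  have [j jm|n0 n0P] := IHm; first by apply: sI; apply: ltnW.
  have [n1 n1P] := sI m (leqnn _); exists (maxn n0 n1) => j.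
  rewrite ltnS leq_eqVlt => /predU1P[->|jm].
    exact: u_mono (leq_maxr _ _) _ n1P.
  exact: u_mono (leq_maxl _ _) _ (n0P _ jm).
exists n0 => n _ x ux; have [Z D M] := u_ideal n0.
have /sP[c [_ ->]] : I x by exists n.
by apply: (big_ind (u n0)) => // i _; apply: M; apply: n0P.
Qed.

Section DownwardClosedSequences.
Variables (d : Order.disp_t) (T : orderType d) (D : pred T).

(** Finite initial segments of [D], listed in decreasing order: removing the head leaves exactly the
    elements of [D] below it. *)
Definition downset (s : seq T) := sorted >%O s /\
  forall e, e \in s -> D e /\ forall e', D e' -> (e' < e)%O -> e' \in s.

Lemma downset_cons e s : downset (e :: s) ->
  [/\ downset s, D e & forall e', e' \in s <-> D e' /\ (e' < e)%O].
Proof.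
move=> [es_sorted es_down]; have [De e_down] := es_down e (mem_head _ _).
have gt_tr : transitive (>%O : rel T) by move=> x y z xy yz; apply: lt_trans yz xy.
have /allP s_lt := order_path_min gt_tr es_sorted.
have sE e' : e' \in s <-> D e' /\ (e' < e)%O.
  split=> [e's|[De' e'e]].
    by have := s_lt _ e's; case: (es_down e'); rewrite // inE e's orbT.
  have := e_down _ De' e'e; rewrite inE => /predU1P[e'E|] //.
  by rewrite e'E ltxx in e'e.
split=> //; split=> [|e1 e1s]; first exact: path_sorted es_sorted.
have [De1 e1e] := (sE e1).1 e1s; split=> // e' De' lt.
by apply/sE; split=> //; apply: lt_trans e1e.
Qed.

Lemma downset_sort s : uniq s ->
  (forall e, e \in s -> D e /\ forall e', D e' -> (e' < e)%O -> e' \in s) ->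
  downset (rev (sort <=%O s)).
Proof.
move=> us s_down; split=> [|e].
  by rewrite rev_sorted sort_lt_sorted.
rewrite mem_rev mem_sort => /s_down[De e_down]; split=> // e' De' lt.
by rewrite mem_rev mem_sort e_down.
Qed.

Variables (R : comNzRingType) (lam : forall M : lmodType R, xreal).
Hypothesis lamP : length_function lam.
Variables (M : lmodType R) (v : T -> M).

Definition below e (x : M) := exists e', [/\ D e', (e' < e)%O & x = v e'].

(** The tail of the list spans the same module as [below e] for the head [e], so each step is one
    use of [len_adjoin]. *)
Lemma len_downset s : downset s ->
  len lam (fun x => exists2 e, e \in s & x = v e) =
  (\sum_(e <- s) cyclic_len lam (quo_proj (below e) (v e)))%E.
Proof.
elim: s => [|e s IHs] es_down.
  by rewrite big_nil; apply: len0 => // x [].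
have [s_down De sE] := downset_cons es_down.
have -> : (\sum_(e' <- e :: s) cyclic_len lam (quo_proj (below e') (v e')) =
    len lam (below e) + cyclic_len lam (quo_proj (below e) (v e)))%E.
  rewrite big_cons -IHs // addeC; congr (_ + _)%E; apply/esym.
  apply: len_eq => // x; split; apply: span_mono => {}x.
    move=> [e' [De' lt ->]]; apply: mem_span; exists e' => //.
    exact/sE.
  by move=> [e' /sE[De' lt] ->]; apply: mem_span; exists e'.
rewrite -len_adjoin //; apply: len_eq => // x; split; apply: span_mono => {}x.
  case=> e'; rewrite inE => /predU1P[->|/sE[De' lt]] ->; apply: mem_span.
    by right.
  by left; exists e'.
case=> [[e' [De' lt ->]]|->]; apply: mem_span.
  by exists e' => //; rewrite inE; apply/orP; right; apply/sE.
by exists e => //; rewrite mem_head.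
Qed.

End DownwardClosedSequences.

(** * From lists of exponents to multinomials *)

Section Multiindices.
Variable k : nat.

(** Lists suit induction on [k]; multinomials carry the monomial order. *)
Definition mnm_of (a : seq nat) : 'X_{1..k} := [multinom nth 0%N a i | i < k].

Lemma mdeg_mnm_of a : size a = k -> mdeg (mnm_of a) = sumn a.
Proof.
move=> sa; rewrite mdegE sumnE (big_nth 0%N) big_mkord sa.
by apply: eq_bigr => i _; rewrite mnmE.
Qed.

Lemma mnm_of_inj a b : size a = k -> size b = k -> mnm_of a = mnm_of b -> a = b.
Proof.
move=> sa sb /mnmP ab; apply: (@eq_from_nth _ 0%N) => [|i ia]; first by rewrite sb.
by rewrite sa in ia; have := ab (Ordinal ia); rewrite !mnmE.
Qed.

Lemma mnm_of_surj m : exists2 a, size a = k & m = mnm_of a.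
Proof.
exists (mkseq (fun i => if insub i is Some j then m j else 0%N) k).
  by rewrite size_mkseq.
by apply/mnmP => i; rewrite mnmE nth_mkseq // valK.
Qed.

Lemma mnm_of_leq a b : all2 leq a b -> (mnm_of a <= mnm_of b)%MM.
Proof.
move=> ab; apply/mnm_lepP => i; rewrite !mnmE.
elim: a b ab {i}(nat_of_ord i) => [|x a IHa] [|y b] //= /andP[xy ab] [|i] //=.
exact: IHa.
Qed.

End Multiindices.

(** * The filtration by degree *)

Section Filtration.
Variables (R : comNzRingType) (k : nat) (N : lmodType {mpoly R[k]}).
(** The pair [(m, i)] stands for the term [x^m g_i]. The order is lexicographic with the monomial
    first, and the monomial order compares degrees first, so a smaller term never has larger
    degree. *)
Local Notation term := ('X_{1..k} *l nat)%type.

Lemma scaler_resR_linear (p : {mpoly R[k]}) :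
  is_linear (fun x : resR N => (p *: (x : N) : resR N)).
Proof.
(* Scaling by [a] in [resR N] is scaling by the constant polynomial [a%:MP]. *)
move=> a u v; suff : p *: (a%:MP *: (u : N) + (v : N)) =
    a%:MP *: (p *: (u : N)) + p *: (v : N) by [].
by rewrite scalerDr !scalerA mulrC.
Qed.

Lemma is_Ssubmodule_resR (U : N -> Prop) :
  is_Ssubmodule U -> is_submodule (U : resR N -> Prop).
Proof. by move=> [U0 UD]; split=> // a u v; apply: UD. Qed.

Lemma spanS_spanR (P : N -> Prop) x : spanS (spanR P) x <-> spanS P x.
Proof.
have SS := span_submodule (P : N -> Prop).
split; apply: span_mono => {}x; last by move=> Px; do 2!apply: mem_span.
apply: (span_min (M := resR N) (Q := spanS P)) x => [|x Px].
  exact: (@is_Ssubmodule_resR (spanS P)).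
exact: (mem_span (M := N)).
Qed.

Lemma SnV_min n (V : N -> Prop) (Q : N -> Prop) :
  is_submodule (Q : resR N -> Prop) ->
  (forall p v, (msize p <= n.+1)%N -> V v -> Q (p *: v)) ->
  forall x, SnV n V x -> Q x.
Proof.
move=> Qsub VQ; apply: (span_min (M := resR N)) => //.
by move=> _ [p [v [sp Vv ->]]]; apply: VQ.
Qed.

Lemma SnV_submodule n (V : N -> Prop) : is_submodule (SnV n V : resR N -> Prop).
Proof. exact: span_submodule. Qed.

Lemma mem_SnV n (V : N -> Prop) p v :
  (msize p <= n.+1)%N -> V v -> SnV n V (p *: v).
Proof. by move=> sp Vv; apply: mem_span; exists p, v. Qed.

Variable g : seq N.

Definition term_dom : pred term := fun e => (e.2 < size g)%N.
Definition term_vec (e : term) : resR N := 'X_[e.1] *: g`_e.2.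

Definition terms n : seq term :=
  [seq (mnm_of k a, i) | i <- iota 0 (size g), a <- box k n].

Lemma mem_terms n e : (e \in terms n) = (mdeg e.1 <= n)%N && term_dom e.
Proof.
apply/allpairsP/andP => [[[i a] /= [ig ab ->]]|].
  rewrite mem_box in ab; case/andP: ab => /eqP sa an.
  by rewrite /= mdeg_mnm_of // /term_dom; rewrite mem_iota in ig.
case: e => m i [/= mn ig]; have [a sa mE] := mnm_of_surj m.
exists (i, a) => /=; rewrite mem_iota mem_box sa eqxx -(mdeg_mnm_of sa) -mE mn.
by split.
Qed.

Lemma terms_uniq n : uniq (terms n).
Proof.
apply: allpairs_uniq; [exact: iota_uniq | exact: box_uniq |].
move=> [i a] [j b] /allpairsP[[i' a'] /= [_ ab [-> ->]]].
move=> /allpairsP[[j' b'] /= [_ bb [-> ->]]] /= ijE.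
have [mE /= ->] := (congr1 fst ijE, congr1 snd ijE).
move: ab bb; rewrite !mem_box => /andP[/eqP sa _] /andP[/eqP sb _].
by rewrite (mnm_of_inj sa sb mE).
Qed.

Lemma term_lt_mdeg (e e' : term) : (e' < e)%O -> (mdeg e'.1 <= mdeg e.1)%N.
Proof. by rewrite ltEprodlexi => /andP[/lemc_mdeg]. Qed.

Lemma terms_downset n : downset term_dom (rev (sort <=%O (terms n))).
Proof.
apply: downset_sort; first exact: terms_uniq.
move=> e; rewrite mem_terms => /andP[en De]; split=> // e' De' /term_lt_mdeg e'e.
by rewrite mem_terms De' (leq_trans e'e).
Qed.

Local Notation V0 := (spanR (fun y => List.In y g)).

Lemma SnV_terms n x : SnV n V0 x <->
  spanR (fun x => exists2 e, e \in terms n & x = term_vec e) x.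
Proof.
split; last first.
  apply: span_mono => _ [e e_n ->]; move: e_n; rewrite mem_terms => /andP[en De].
  apply: mem_SnV; first by rewrite msizeX ltnS.
  by apply: mem_span; apply/List_InE/mem_nth.
apply: SnV_min => [|p v sp]; first exact: span_submodule.
apply: (span_min (M := resR N) (Q := fun v => spanR _ (p *: (v : N)))).
  exact: preimage_submodule (scaler_resR_linear p) _ (span_submodule _).
move=> y /List_InE yg; rewrite (mpolyE p) scaler_suml big_seq.
apply: (big_ind (spanR _)).
- exact: (span_submodule (M := resR N) _).1.
- exact: (submodD (span_submodule (M := resR N) _)).
move=> m mp; rewrite -mul_mpolyC -scalerA.
apply: (submodZ (span_submodule (M := resR N) _)).
apply: mem_span; exists (m, index y g); last by rewrite /term_vec /= nth_index.
rewrite mem_terms /term_dom /= index_mem yg andbT.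
by rewrite -ltnS (leq_trans _ sp) // msize_mdeg_lt.
Qed.

Local Notation below := (below term_dom term_vec).

Lemma term_vecM m c i :
  'X_[c] *: (term_vec (m, i) : N) = term_vec ((m + c)%MM, i).
Proof. by rewrite /term_vec /= scalerA -mpolyXD addmC. Qed.

(** The order on terms is invariant under multiplication by a monomial. *)
Lemma below_mul (m c : 'X_{1..k}) i x : spanR (below (m, i)) x ->
  spanR (below ((m + c)%MM, i)) ('X_[c] *: x).
Proof.
move=> /(span_image (scaler_resR_linear 'X_[c])); apply: span_mono.
move=> _ [_ [[m' j] [De' lt ->]] ->]; apply: mem_span.
exists ((m' + c)%MM, j); split=> //.
  by move: lt; rewrite !ltEprodlexi /= !lemc_add2l.
by rewrite term_vecM.
Qed.

(** Terms may be linearly dependent, so leading coefficients make sense only through a congruence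
    modulo smaller terms. For [U = 0] this is the colon ideal of [r] with [r] times the term in the
    span of the smaller ones. *)
Definition lead_coefs (U : N -> Prop) (e : term) (r : R) :=
  exists2 u, U u & spanR (below e) (r%:MP *: (term_vec e : N) - u).

Lemma lead_coefs_ideal (U : N -> Prop) e :
  is_submodule (U : resR N -> Prop) -> is_ideal (lead_coefs U e).
Proof.
move=> US; have BS := span_submodule (M := resR N) (below e).
split=> [|r s [u Uu Hr] [v Uv Hs]|a r [u Uu Hr]].
- by exists 0; [apply: US.1 | rewrite mpolyC0 scale0r subr0; apply: BS.1].
- exists (u + v); first exact: (submodD US).
  by rewrite mpolyCD scalerDl opprD addrACA; apply: (submodD BS).
- exists (a%:MP *: u); first exact: (submodZ US a).
  by rewrite mpolyCM -scalerA -scalerBr; apply: (submodZ BS a).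
Qed.

Lemma lead_coefs_mono (U : N -> Prop) m c i r : is_Ssubmodule U ->
  lead_coefs U (m, i) r -> lead_coefs U ((m + c)%MM, i) r.
Proof.
move=> US [u Uu Hr]; exists ('X_[c] *: u).
  by apply: (submodZ (P := U)).
have := below_mul c Hr; rewrite scalerBr scalerA mulrC -scalerA.
by rewrite term_vecM.
Qed.

Lemma lead_coefs_subset (U U' : N -> Prop) e r :
  (forall u, U u -> U' u) -> lead_coefs U e r -> lead_coefs U' e r.
Proof. by move=> UU' [u /UU' Uu Hr]; exists u. Qed.

Hypothesis noeth : noetherian R.

(** One element of [U] is chosen for each generator of the ideal; combinations of generators are
    realised by combinations of these elements. *)
Lemma lead_coefs_fg (U : N -> Prop) e : is_submodule (U : resR N -> Prop) ->
  exists w : seq N, (forall u, List.In u w -> U u) /\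
  forall r, lead_coefs U e r -> lead_coefs (spanR (fun y => List.In y w)) e r.
Proof.
move=> US; have [s sP] := noeth (lead_coefs_ideal e US).
have [w wU wP] : exists2 w : seq N, forall u, List.In u w -> U u &
    forall r, r \in s -> lead_coefs (spanR (fun y => List.In y w)) e r.
  have sU r : r \in s -> lead_coefs U e r.
    move=> rs; apply/sP; exists (mkseq (fun i => (i == index r s)%:R) (size s)).
    rewrite size_mkseq; split=> //; have js : (index r s < size s)%N by rewrite index_mem.
    rewrite (bigD1 (Ordinal js)) //= nth_mkseq // eqxx mul1r nth_index //.
    rewrite big1 ?addr0 // => i ij.
    by rewrite nth_mkseq // (negbTE (ij : val i != index r s)) mul0r.
  elim: s {sP} sU => [|r s IHs] sU; first by exists [::].
  have [|w wU wP] := IHs; first by move=> r' r's; apply: sU; rewrite inE r's orbT.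
  have [u Uu Hr] := sU r (mem_head _ _).
  exists (u :: w) => [_ [<-|/wU]|r'] //; rewrite inE => /predU1P[->|r's].
    by exists u => //; apply: mem_span; left.
  apply: lead_coefs_subset (wP _ r's); apply: (span_mono (M := resR N)) => y yw.
  by apply: mem_span; right.
exists w; split=> // r /sP[c [_ ->]].
have [] := lead_coefs_ideal e (span_submodule (M := resR N) (fun y => List.In y w)).
move=> Z D M; apply: (big_ind (lead_coefs _ e)) => // i _; apply: M; apply: wP.
exact: mem_nth.
Qed.

Lemma lead_coefs_fg_seq (U : N -> Prop) (es : seq term) :
  is_submodule (U : resR N -> Prop) ->
  exists w : seq N, (forall u, List.In u w -> U u) /\
  forall e r, e \in es -> lead_coefs U e r ->
    lead_coefs (spanR (fun y => List.In y w)) e r.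
Proof.
move=> US; elim: es => [|e es [w [wU wP]]]; first by exists [::].
have [w' [wU' wP']] := lead_coefs_fg e US.
exists (w ++ w'); split=> [u /List_InE|e' r].
  by rewrite mem_cat => /orP[] /List_InE; [apply: wU | apply: wU'].
rewrite inE => /predU1P[->|e's] Ur.
  apply: lead_coefs_subset (wP' _ Ur); apply: (span_mono (M := resR N)) => y /List_InE yw.
  by apply/mem_span/List_InE; rewrite mem_cat yw orbT.
apply: lead_coefs_subset (wP _ _ e's Ur); apply: (span_mono (M := resR N)) => y /List_InE yw.
by apply/mem_span/List_InE; rewrite mem_cat yw.
Qed.

Lemma lead_coefs_mnm_mono (U : N -> Prop) a b i r : is_Ssubmodule U ->
  all2 leq a b -> lead_coefs U (mnm_of k a, i) r -> lead_coefs U (mnm_of k b, i) r.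
Proof.
move=> US /(mnm_of_leq k) ab.
by rewrite -(submK ab) addmC; apply: lead_coefs_mono.
Qed.

Lemma ideal_subset_trans (I J L : R -> Prop) :
  (forall x, I x -> J x) -> (forall x, J x -> L x) -> forall x, I x -> L x.
Proof. by move=> IJ JL x /IJ/JL. Qed.

(** By [finite_basis], for each generator index, finitely many terms control all leading coefficient
    ideals. A realisation at a controlling term [b] is carried to [a] by the monomial [x^(a-b)],
    whose degree is at most that of [a]; hence the bound [mdeg e.1]. *)
Lemma lead_coefs_basis (U : N -> Prop) : is_Ssubmodule U ->
  exists w : seq N, (forall u, List.In u w -> U u) /\
  forall e r, term_dom e -> lead_coefs U e r ->
    lead_coefs (fun u => U u /\
      SnV (mdeg e.1) (spanR (fun y => List.In y w)) u) e r.
Proof.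
move=> US; have USR := is_Ssubmodule_resR US.
have [es esP] : exists es : seq term, forall a i, size a = k -> (i < size g)%N ->
    exists b, [/\ (mnm_of k b, i) \in es, all2 leq b a & forall r,
      lead_coefs U (mnm_of k a, i) r -> lead_coefs U (mnm_of k b, i) r].
  elim: (size g) => [|m [es esP]]; first by exists [::].
  have [||Bs BsP] := finite_basis (F := fun a => lead_coefs U (mnm_of k a, m))
    ideal_subset_trans (noetherian_acc noeth) (k := k).
  - by move=> a; apply: lead_coefs_ideal.
  - by move=> a b _ ab r; apply: lead_coefs_mnm_mono.
  exists ([seq (mnm_of k b, m) | b <- Bs] ++ es) => a i sa.
  rewrite ltnS leq_eqVlt => /predU1P[->|im].
    have [b [bB ba Fb]] := BsP _ sa; exists b; split=> //.
    by rewrite mem_cat; apply/orP; left; apply/mapP; exists b.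
  have [b [bB ba Fb]] := esP _ _ sa im; exists b; split=> //.
  by rewrite mem_cat bB orbT.
have [w [wU wP]] := lead_coefs_fg_seq es USR; exists w; split=> // -[m i] r De Hr.
have [a sa mE] := mnm_of_surj m; rewrite {m}mE in De Hr *.
have [b [bes ba Fb]] := esP a i sa De.
have [u wu Hu] := wP _ _ bes (Fb _ Hr).
have ab := mnm_of_leq k ba.
have Uu : U u by move: wu; apply: span_min.
pose c := (mnm_of k a - mnm_of k b)%MM.
have aE : mnm_of k a = (mnm_of k b + c)%MM by rewrite addmC submK.
exists ('X_[c] *: u).
  split; first exact: (submodZ (P := U)).
  by apply: mem_SnV => //; rewrite msizeX ltnS /= aE mdegD leq_addl.
have := below_mul c Hu; rewrite scalerBr scalerA mulrC -scalerA.
by rewrite term_vecM -aE.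
Qed.

(* Division algorithm: an element of [U] in the filtration is reduced, leading
   term after leading term, by multiples of the elements of [w]. *)
Lemma artin_rees (U : N -> Prop) : is_Ssubmodule U ->
  exists w : seq N, (forall u, List.In u w -> U u) /\
  forall n x, U x -> SnV n V0 x -> SnV n (spanR (fun y => List.In y w)) x.
Proof.
move=> US; have [w [wU wP]] := lead_coefs_basis US; exists w; split=> // n x Ux.
have USR := is_Ssubmodule_resR US.
set W := spanR (fun y => List.In y w) in wP *.
have WS := SnV_submodule n W.
have mem_s e : e \in rev (sort <=%O (terms n)) -> (mdeg e.1 <= n)%N.
  by rewrite mem_rev mem_sort mem_terms => /andP[].
move=> /SnV_terms xn.
have : spanR (fun x => exists2 e, e \in rev (sort <=%O (terms n)) &
    x = term_vec e) x.
  move: xn; apply: span_mono => _ [e e_n ->]; apply: mem_span; exists e => //.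
  by rewrite mem_rev mem_sort.
elim: (rev _) (terms_downset n) mem_s x Ux {xn} => [|e s IHs] es_down mem_s x Ux xs.
  have -> : x = 0; last exact: WS.1.
  move: xs; apply: (span_min (Q := fun x => x = 0)) => [|y [] //].
  by split=> // a u v -> ->; rewrite scaler0 addr0.
have [s_down De sE] := downset_cons es_down.
have sB y : spanR (below e) y ->
    spanR (fun x => exists2 e, e \in s & x = term_vec e) y.
  apply: span_mono => _ [e' [De' lt ->]]; apply: mem_span; exists e' => //.
  exact/sE.
have [a Ha] : exists a : R, spanR (below e) (x - a%:MP *: (term_vec e : N)).
  apply: (span_adjoin (M := resR N)); move: xs; apply: span_mono => _ [e' e's ->].
  apply: mem_span; move: e's; rewrite inE => /predU1P[->|/sE[De' lt]].
    by right.
  by left; exists e'.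
have BS := span_submodule (M := resR N) (below e).
have [|u [Uu Wu] Hu] := wP e a De.
  exists x => //; rewrite -opprB -scaleN1r -mpolyC1 -mpolyCN.
  exact: (submodZ BS (-1)).
have Wn : SnV n W u.
  move: Wu; apply: SnV_min => // p v sp Wv; apply: mem_SnV => //.
  by apply: leq_trans sp _; rewrite ltnS mem_s ?mem_head.
rewrite -[x](subrK u); apply: (submodD WS) => //.
apply: IHs => // [e' e's||]; first by apply: mem_s; rewrite inE e's orbT.
  exact: (submodB USR).
apply: sB; rewrite -[x](subrK (a%:MP *: (term_vec e : N))) -addrA.
exact: (submodD BS).
Qed.

Variable lam : forall M : lmodType R, xreal.
Hypothesis lamP : length_function lam.
Hypothesis Nfin : loc_finite lam (fun _ : N => True).

Lemma term_cyclic_len_fin e :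
  cyclic_len lam (quo_proj (below e) (term_vec e)) \is a fin_num.
Proof.
rewrite ge0_fin_numE ?len_ge0 //.
apply: le_lt_trans (cyclic_len_quo_le lamP _ _) _.
rewrite /cyclic_len (_ : len lam _ = lamR lam (spanR (fun y => y = (term_vec e : N)))).
  exact: Nfin.
by apply: len_eq => // x; rewrite span_span.
Qed.

Lemma hilbert_polynomial : exists q : {poly Rdefinitions.R},
  (size q <= k.+1)%N /\ exists n0, forall n, (n0 <= n)%N ->
    lamR lam (SnV n V0) = (q.[n%:R])%:E.
Proof.
pose f e := fine (cyclic_len lam (quo_proj (below e) (term_vec e))).
(* Every summand is finite by local finiteness, so passing to real numbers with [fine] loses
   nothing. *)
have lenE n : lamR lam (SnV n V0) = (\sum_(e <- terms n) f e)%:E.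
  rewrite (_ : lamR lam _ = len lam (fun x => exists2 e,
      e \in rev (sort <=%O (terms n)) & x = term_vec e)); last first.
    apply: len_eq => // x; rewrite span_span; split=> [/SnV_terms|].
      by apply: span_mono => _ [e e_n ->]; apply: mem_span; exists e => //;
        rewrite mem_rev mem_sort.
    move=> H; apply/SnV_terms; move: H; apply: span_mono => _ [e e_n ->].
    by apply: mem_span; exists e => //; move: e_n; rewrite mem_rev mem_sort.
  rewrite (len_downset lamP _ (terms_downset n)) -sumEFin.
  rewrite (perm_big (terms n)) /=; last by rewrite perm_rev perm_sort.
  by apply: eq_bigr => e _; rewrite fineK // term_cyclic_len_fin.
have : evpoly k (fun n => \sum_(i <- iota 0 (size g))
    \sum_(a <- box k n) f (mnm_of k a, i)).
  apply: evpoly_sum => i.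
  have US : is_Ssubmodule (fun x : N => x = 0).
    by split=> // a u v -> ->; rewrite scaler0 addr0.
  (* With [U = 0] the family consists of colon ideals, and equal colon ideals give cyclic quotients
     of equal length. *)
  apply: (evpoly_box (F := fun a => lead_coefs (fun x : N => x = 0) (mnm_of k a, i))
    ideal_subset_trans (noetherian_acc noeth)).
  - move=> a; apply: lead_coefs_ideal; exact: is_Ssubmodule_resR.
  - by move=> a b _ ab r; apply: lead_coefs_mnm_mono.
  move=> a b _ _ ab ba; congr fine; apply: cyclic_len_colon => // r.
  have colon e : span (below e) (r *: term_vec e) <->
      lead_coefs (fun x : N => x = 0) e r.
    split=> [H|[_ -> ]]; first by exists 0 => //; rewrite subr0.
    by rewrite subr0.
  by split=> /colon; [move/ab | move/ba] => /colon.
case=> q [sq [n0 n0P]]; exists q; split=> //; exists n0 => n /n0P <-.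
by rewrite lenE [in LHS]/terms big_allpairs_dep.
Qed.

End Filtration.

(** * Additivity *)

Section Mu.
Variables (R : comNzRingType) (lam : forall M : lmodType R, xreal) (k : nat).
Hypothesis lamP : length_function lam.
Hypothesis noeth : noetherian R.

Section OneModule.
Variable N : lmodType {mpoly R[k]}.
Implicit Types g : seq N.

Definition genR g : N -> Prop := spanR (fun y => List.In y g).

Definition hilbert_poly g (q : {poly Rdefinitions.R}) :=
  (size q <= k.+1)%N /\ exists n0, forall n, (n0 <= n)%N ->
    lamR lam (SnV n (genR g)) = (q.[n%:R])%:E.

Definition lead_monos : set mono :=
  [set m | exists g q, hilbert_poly g q /\ m = leadmono q].

Lemma hilbert_poly_ge0 g q : hilbert_poly g q -> ev_ge0 q.
Proof.
move=> [_ [n0 n0P]]; exists n0 => n /n0P qn.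
by rewrite -lee_fin -qn; apply: len_ge0.
Qed.

Lemma lead_monos_deg m : lead_monos m -> mono_deg_le k m.
Proof. by move=> [g [q [[sq _] ->]]]; apply: leadmono_deg. Qed.

Lemma lead_monos_ge0 m : lead_monos m -> mono_ge0 m.
Proof. by move=> [g [q [/hilbert_poly_ge0 q0 ->]]]; apply: leadmono_ge0. Qed.

Lemma SnV_mono n (V V' : N -> Prop) x :
  (forall v, V v -> V' v) -> SnV n V x -> SnV n V' x.
Proof.
move=> VV'; apply: SnV_min; first exact: SnV_submodule.
by move=> p v sp /VV' Vv; apply: mem_SnV.
Qed.

Lemma SnV_span n (V : N -> Prop) x : @span R (resR N) (SnV n V) x -> SnV n V x.
Proof. by move/span_span. Qed.

Lemma lamR_le (P Q : N -> Prop) :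
  (forall x, P x -> spanR Q x) -> (lamR lam P <= lamR lam Q)%E.
Proof. exact: (@len_le _ _ lamP (resR N)). Qed.

Lemma lamR_SnV_eq n (V V' : N -> Prop) : (forall v, V v <-> V' v) ->
  lamR lam (SnV n V) = lamR lam (SnV n V').
Proof.
move=> VV'; apply/le_anti/andP; split; apply: lamR_le => x xV;
  by apply: (mem_span (M := resR N)); move: xV; apply: SnV_mono => v /VV'.
Qed.

Hypothesis Nfin : loc_finite lam (fun _ : N => True).

Lemma lead_monos_neq0 : (lead_monos !=set0)%classic.
Proof.
have [q qP] := hilbert_polynomial [::] noeth lamP Nfin.
by exists (leadmono q), [::], q.
Qed.

(** The module lies in [S_n0 V_0], whose length is a value of the Hilbert polynomial. *)
Lemma genR_fin g : (lamR lam (genR g) < +oo)%E.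
Proof.
have [q [_ [n0 n0P]]] := hilbert_polynomial g noeth lamP Nfin.
apply: (@le_lt_trans _ _ (lamR lam (SnV n0 (genR g)))); last first.
  by rewrite n0P // ltry.
apply: lamR_le => x xg; apply: (mem_span (M := resR N)).
by rewrite -[x]scale1r; apply: mem_SnV => //; rewrite msize1.
Qed.

(** Under local finiteness every finite list generates a small S-submodule, so finite lists replace
    small submodules in the supremum. *)
Lemma mu_lead_monos : mu lam N = msup lead_monos.
Proof.
congr msup; apply/seteqP; split=> m.
  move=> [P [_ [g [_ _ _ [q [sq qP ->]]]]]]; exists g, q; split=> //.
move=> [g [q [[sq qP] ->]]].
have gS := span_submodule (genR g : N -> Prop).
exists (spanS (genR g)); split; last first.
  exists g; split=> //; last by exists q.
    by move=> v vg; do 2!apply: mem_span.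
  exact: genR_fin.
split=> //; first by exists g => x; apply: spanS_spanR.
by move=> v _; apply: Nfin.
Qed.

End OneModule.

(** * Filtrations under linear maps *)

Section Morphism.
Variables (M N : lmodType {mpoly R[k]}) (f : M -> N).
Hypothesis f_lin : is_linear f.

Lemma is_linear_resR : is_linear (f : resR M -> resR N).
Proof. by move=> a u v; apply: f_lin. Qed.

Lemma genR_image g y : genR (map f g) y <-> exists2 x, genR g x & y = f x.
Proof.
split.
  move: y; apply: (span_min (M := resR N)).
    exact: (image_submodule is_linear_resR (span_submodule _)).
  move=> y /List_InE /mapP[x xg ->]; exists x => //; apply: mem_span.
  exact/List_InE.
case=> x + ->; move: x; apply: (span_min (M := resR M)
    (Q := fun x => genR (map f g) (f x))) => [|x /List_InE xg].
  exact: (preimage_submodule is_linear_resR (span_submodule _)).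
by apply: mem_span; apply/List_InE/map_f.
Qed.

Lemma SnV_image n g y :
  SnV n (genR (map f g)) y <-> exists2 x, SnV n (genR g) x & y = f x.
Proof.
split.
  move: y; apply: SnV_min.
    exact: (image_submodule is_linear_resR (SnV_submodule n (genR g))).
  move=> p v sp /genR_image[x xg ->]; exists (p *: x); first exact: mem_SnV.
  by rewrite is_linearZ.
case=> x + ->; move: x; apply: (SnV_min (Q := fun x => SnV _ _ (f x))).
  exact: (preimage_submodule is_linear_resR (SnV_submodule n _)).
move=> p v sp vg; rewrite is_linearZ //; apply: mem_SnV => //.
by apply/genR_image; exists v.
Qed.

Lemma lamR_SnV_image n g : lamR lam (SnV n (genR (map f g))) =
  len lam (fun y : resR N => exists2 x,
    span (SnV n (genR g) : resR M -> Prop) x & y = f x).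
Proof.
apply: len_eq => // y; split; apply: span_mono => {}y.
  move=> /SnV_image[x xn ->]; apply: mem_span; exists x => //.
  exact: mem_span.
move=> [x /SnV_span xn ->]; apply: mem_span.
by apply/SnV_image; exists x.
Qed.

Lemma lamR_SnV_inj n g : injective f ->
  lamR lam (SnV n (genR (map f g))) = lamR lam (SnV n (genR g)).
Proof.
move=> f_inj; rewrite lamR_SnV_image; apply/esym.
apply: (len_image_inj lamP is_linear_resR) => x _ fx0; apply: f_inj.
by rewrite fx0 (is_linear0 f_lin).
Qed.

End Morphism.

(** * The two inequalities for a short exact sequence *)

Section ExactSequence.
Variables (A B C : lmodType {mpoly R[k]}) (iota : A -> B) (pi : B -> C).
Hypothesis exactABC : short_exact iota pi.
Hypothesis Bfin : loc_finite lam (fun _ : B => True).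

Lemma loc_finite_sub : loc_finite lam (fun _ : A => True).
Proof.
case: exactABC => iota_lin _ iota_inj _ _ v _; apply: le_lt_trans (Bfin (v := iota v) I).
rewrite /lamR -!/(len lam _) (len_image_inj lamP (is_linear_resR iota_lin)).
  apply: len_le => // _ [x /span_span/span1[a ->] ->]; apply: mem_span.
  by apply/span1; exists a; rewrite (is_linearZ (is_linear_resR iota_lin)).
by move=> x _ ix0; apply: iota_inj; rewrite ix0 (is_linear0 iota_lin).
Qed.

Lemma loc_finite_quot : loc_finite lam (fun _ : C => True).
Proof.
case: exactABC => _ pi_lin _ pi_surj _ v _; have [b bv] := pi_surj v.
apply: le_lt_trans (Bfin (v := b) I).
apply: le_trans (len_image_le lamP _ (is_linear_resR pi_lin)).
apply: len_le => // _ /span1[a ->]; apply: mem_span; exists (a%:MP *: b).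
  by apply: mem_span; apply/span1; exists a.
by rewrite (is_linearZ pi_lin) bv.
Qed.

(** The filtration of [B] maps onto the one of [C] generated by the images; only the kernel part is
    not itself a filtration by degree. *)
Lemma lamR_SnV_exact n g : lamR lam (SnV n (genR g)) =
  (len lam (fun x : resR B => span (SnV n (genR g) : resR B -> Prop) x /\ pi x = 0%R)
   + lamR lam (SnV n (genR (map pi g))))%E.
Proof.
case: exactABC => _ pi_lin _ _ _; rewrite lamR_SnV_image //.
exact: (len_additive lamP _ (is_linear_resR pi_lin)).
Qed.

Lemma ker_submodule : is_Ssubmodule (fun x => pi x = 0).
Proof.
case: exactABC => _ pi_lin _ _ _; split=> [|a u v]; first exact: is_linear0.
by rewrite pi_lin => -> ->; rewrite scaler0 addr0.
Qed.

Lemma lead_mono_upper m : lead_monos B m -> exists mA mC,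
  [/\ lead_monos A mA, lead_monos C mC & mono_le m (moplus mA mC)].
Proof.
case: exactABC => iota_lin pi_lin iota_inj pi_surj ex [g [q [gq ->]]].
have [w [wU wP]] := artin_rees g noeth ker_submodule.
(* The elements of [w] lie in the kernel of [pi], hence lift to [A] by exactness. *)
have [wA wE] : exists wA, w = map iota wA.
  elim: w wU {wP} => [|u w IHw] wU; first by exists [::].
  have [|wA ->] := IHw; first by move=> v vw; apply: wU; right.
  have /ex[a ->] := wU u (or_introl erefl).
  by exists (a :: wA).
have [qA qAP] := hilbert_polynomial wA noeth lamP loc_finite_sub.
have [qC qCP] := hilbert_polynomial (map pi g) noeth lamP loc_finite_quot.
have [qA0 qC0] := (hilbert_poly_ge0 qAP, hilbert_poly_ge0 qCP).
exists (leadmono qA), (leadmono qC); split; [by exists wA, qA | by exists (map pi g), qC |].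
rewrite -leadmonoD //; apply: leadmono_le; first exact: hilbert_poly_ge0 gq.
case: gq qAP qCP => _ [n0 n0P] [_ [n1 n1P]] [_ [n2 n2P]].
exists (maxn n0 (maxn n1 n2)) => n; rewrite !geq_max.
case/and3P=> /n0P Eq /n1P EA /n2P EC.
rewrite hornerD hornerN subr_ge0 hornerD -lee_fin EFinD -Eq -EA -EC.
rewrite lamR_SnV_exact leeD2r // -(lamR_SnV_inj iota_lin) // -wE.
apply: len_le => // x [/SnV_span xn pix].
by apply: mem_span; apply: wP.
Qed.

Lemma lead_mono_lower mA mC : lead_monos A mA -> lead_monos C mC ->
  exists2 m, lead_monos B m & mono_le (moplus mA mC) m.
Proof.
case: exactABC => iota_lin pi_lin iota_inj pi_surj ex.
move=> [gA [qA [qAP ->]]] [gC [qC [qCP ->]]].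
have [hC gCE] : exists hC, gC = map pi hC.
  elim: gC {qCP} => [|c gC [hC ->]]; first by exists [::].
  by have [b <-] := pi_surj c; exists (b :: hC).
(* The part from [A] fills the kernel of [pi], and the lifts [hC] recover [gC] in the quotient. *)
pose g := map iota gA ++ hC.
have [q qP] := hilbert_polynomial g noeth lamP Bfin.
have [qA0 qC0] := (hilbert_poly_ge0 qAP, hilbert_poly_ge0 qCP).
exists (leadmono q); first by exists g, q.
rewrite -leadmonoD //; apply: leadmono_le.
  have [[n0 n0P] [n1 n1P]] := (qA0, qC0).
  exists (maxn n0 n1) => n; rewrite geq_max hornerD => /andP[/n0P ? /n1P ?].
  exact: addr_ge0.
case: qP qAP qCP => _ [n0 n0P] [_ [n1 n1P]] [_ [n2 n2P]].
exists (maxn n0 (maxn n1 n2)) => n; rewrite !geq_max.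
case/and3P=> /n0P Eq /n1P EA /n2P EC.
rewrite hornerD hornerN subr_ge0 hornerD -lee_fin EFinD -Eq -EA -EC.
rewrite lamR_SnV_exact -(lamR_SnV_inj iota_lin) //; apply: leeD; last first.
  (* The images of [gA] vanish in [C], so [map pi g] and [gC] generate the same R-module. *)
  rewrite le_eqVlt (@lamR_SnV_eq _ _ _ (genR (map pi g))) ?eqxx // => v.
  rewrite gCE /genR; split; apply: span_mono => y /List_InE.
    by move=> yg; apply/mem_span/List_InE; rewrite map_cat mem_cat yg orbT.
  rewrite map_cat mem_cat => /orP[|yg]; last exact/mem_span/List_InE.
  case/mapP=> _ /mapP[a _ ->] ->.
  have -> : pi (iota a) = 0 by apply/ex; exists a.
  exact: (span_submodule (M := resR C) _).1.
apply: len_le => // x xA; apply: mem_span; split.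
  apply: mem_span; move: xA; apply: SnV_mono => v.
  apply: span_mono => y /List_InE yg; apply/mem_span/List_InE.
  by rewrite mem_cat yg.
by have /SnV_image[//|a _ ->] := xA; apply/ex; exists a.
Qed.

Lemma mu_exact : mu lam B = moplus (mu lam A) (mu lam C).
Proof.
have [Afin Cfin] := (loc_finite_sub, loc_finite_quot).
rewrite !mu_lead_monos //; apply: mono_le_anti.
  apply: (msup_le (@lead_monos_deg B)) => m /lead_mono_upper[mA [mC [Am Cm le]]].
  apply: mono_le_trans le _; apply: moplus_mono.
  - exact: msup_ge0 (@lead_monos_deg A) (@lead_monos_ge0 A).
  - exact: msup_ge0 (@lead_monos_deg C) (@lead_monos_ge0 C).
  - exact: (msup_ub (@lead_monos_deg A)).
  - exact: (msup_ub (@lead_monos_deg C)).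
apply: (moplus_msup_le (@lead_monos_deg A) (@lead_monos_deg C)).
- exact: lead_monos_ge0.
- exact: lead_monos_ge0.
- exact: lead_monos_neq0.
- exact: lead_monos_neq0.
move=> mA mC Am Cm; have [m Bm le] := lead_mono_lower Am Cm.
exact: mono_le_trans le (msup_ub (@lead_monos_deg B) Bm).
Qed.

End ExactSequence.
End Mu.

Theorem theorem6p1 (R : comNzRingType) (lam : forall M : lmodType R, xreal)
    (k : nat) (A B C : lmodType {mpoly R[k]}) (iota : A -> B) (pi : B -> C) :
  noetherian R -> length_function lam ->
  short_exact iota pi ->
  loc_finite lam (fun _ : B => True) ->
  mu lam B = moplus (mu lam A) (mu lam C).
Proof. by move=> noeth lamP ex Bfin; apply: mu_exact ex Bfin. Qed.
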